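(* Let $N,p,q$ be three positive integers such that $q$ is odd and $\gcd(p,q)=\gcd(N,q)=\gcd(N,p)=1$, and let $A,B$ be two integers such that $2NA+Bq=1$. For $i\in\{1,\dots,N-1\}$ let $$\epsilon_{N,q,p}(i)=(-1)^{\left[\frac{pBi}{N}\right]},$$ where $[\ ]$ denotes the integral part (floor), and define in the braid group on $N$ strands, with standard generators $\sigma_1,\dots,\sigma_{N-1}$, $$\alpha_{N,q,p}=\prod_{2\le 2i\le N-1}\sigma_{2i}^{\epsilon_{N,q,p}(2i)},\qquad \beta_{N,q,p}=\prod_{1\le 2i+1\le N-1}\sigma_{2i+1}^{\epsilon_{N,q,p}(2i+1)}.$$ For $k\in\{1,\dots,2q\}$ with $k\ne q$, $k\neq 2q$, let $$\lambda(k)=\lambda_{N,q,p}(k)=(-1)^{\left[\frac{2Apk}{q}\right]}.$$ Put $$Q_{N,q,p}=\alpha_{N,q,p}^{\lambda(1)}\beta_{N,q,p}^{\lambda(2)}\cdots\alpha_{N,q,p}^{\lambda(q-2)}\beta_{N,q,p}^{\lambda(q-1)}$$ (factors $\alpha_{N,q,p}$ and $\beta_{N,q,p}$ alternate, $q-1$ factors in all), so that $$Q_{N,q,p}^{-1}=\beta_{N,q,p}^{-\lambda(q-1)}\alpha_{N,q,p}^{-\lambda(q-2)}\cdots\beta_{N,q,p}^{-\lambda(2)}\alpha_{N,q,p}^{-\lambda(1)}.$$ Then, up to mirror transformation, the knot $K(N,q,p)$ is represented by (is the closure of) the braid $$B_{N,q,p}=Q_{N,q,p}\,\alpha_{N,q,p}\,Q_{N,q,p}^{-1}\,\beta_{N,q,p}.$$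 The $k$-th of the $2q$ factors $\alpha_{N,q,p}^{\pm1},\beta_{N,q,p}^{\pm1}$ in this expression corresponds to the $k$-th crossing value $t_k$, where $t_1<t_2<\dots<t_{2q}$ are the $2q$ crossing values in $[\eta,1+\eta]$.
   Context: Definition of $K(N,q,p)$: for positive integers $N,q,p$ with $\gcd(N,q)=\gcd(N,p)=1$ and $\phi\in\mathbb{R}$, $K(N,q,p,\phi)$ is the closed curve in $\mathbb{R}^3$ given for $t\in[0,2\pi]$ by $x=(2+\sin(qt))\cos(Nt)$, $y=(2+\sin(qt))\sin(Nt)$, $z=\cos(p(t+\phi))$; equivalently the closed $N$-braid $e^{it}\mapsto(e^{iNt},\sin(qt),\cos(p(t+\phi)))$ in $\mathbb{S}^1\times\mathbb{R}^2$. The phase $\phi$ is called critical if the knot is singular for this phase. For non-critical $\phi$ the knot type does not depend on $\phi$ up to mirror image; it is denoted $K(N,q,p)$. Geometric braid: the knot is the closure of the braid $B_{N,q,p}$ consisting of the graphs over $[\eta,1+\eta]$ (with $\eta>0$ small, so that no crossing occurs at the endpoints) of the $N$ functions $$\psi_k(t)=\big(\psi_k^{(1)}(t),\psi_k^{(2)}(t)\big)=\Big(\sin\tfrac{2\pi q}{N}(t+k),\ \cos\tfrac{2\pi p}{N}(t+k+\phi)\Big),\qquad k=0,\dots,N-1,$$ for a non-critical phase $\phi$ (which, after the change of parameter, is rescaled compared with the phase of the curve above). The braid is read by projecting to the first two coordinates $(t,y)$, $y=\psi_k^{(1)}(t)$; strands are counted from the largest $y$. A crossing value is a number $t\in[\eta,1+\eta]$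 for which $\psi^{(1)}_k(t)=\psi^{(1)}_l(t)$ for some $k\ne l$ in $\{0,\dots,N-1\}$; the corresponding points are the crossing points, and the factor corresponding to a crossing value is the braid formed by the crossing points lying above it. Mirror transformation on braids means replacing every $\sigma_i$ by $\sigma_i^{-1}$.
   Formalization: k-th factor at t_k is proved for some η in (0,1); for small η, only at a suitable phase, and shifted by one factor if N≡0,3 mod 4, where the first crossing is of β type. For N≤2 there are fewer than 2q crossing values; the other t_k carry trivial factors. *)

(* Defs.v *)
From HB Require Import structures.
From mathcomp Require Import all_boot all_order all_algebra.
From mathcomp Require Import generic_quotient.
From mathcomp Require Import all_classical all_reals all_analysis.

Set Implicit Arguments.
Unset Strict Implicit.
Unset Printing Implicit Defensive.
Import Order.TTheory GRing.Theory Num.Theory.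
Import numFieldNormedType.Exports.
Local Open Scope classical_set_scope.
Local Open Scope ring_scope.

(* A letter [(i, b)], with [i] counted from 0, stands for the generator
   sigma_{i+1} if [b] is true and for its inverse otherwise; [n] is the number
   of generators, one less than the number of strands. *)
Definition braid_word (n : nat) : Type := seq ('I_n * bool).

HB.instance Definition _ n := Choice.on (braid_word n).

Definition flip_letter (n : nat) (x : 'I_n * bool) : 'I_n * bool :=
  (x.1, ~~ x.2).

Definition word_inv (n : nat) (w : braid_word n) : braid_word n :=
  rev (map (@flip_letter n) w).

Inductive braid_eq (n : nat) : braid_word n -> braid_word n -> Prop :=
| braid_eq_refl w : braid_eq w w
| braid_eq_sym v w : braid_eq v w -> braid_eq w v
| braid_eq_trans u v w : braid_eq u v -> braid_eq v w -> braid_eq u w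
| braid_eq_cat v v' w w' :
    braid_eq v v' -> braid_eq w w' -> braid_eq (v ++ w) (v' ++ w')
| braid_eq_cancel x : braid_eq [:: x; flip_letter x] [::]
| braid_eq_far (i j : 'I_n) : (i.+1 < j)%N ->
    braid_eq [:: (i, true); (j, true)] [:: (j, true); (i, true)]
| braid_eq_braid (i j : 'I_n) : i.+1 = j ->
    braid_eq [:: (i, true); (j, true); (i, true)]
             [:: (j, true); (i, true); (j, true)].

Definition braid_eqb (n : nat) (v w : braid_word n) : bool := `[< braid_eq v w >].

Lemma braid_eqb_refl n : reflexive (@braid_eqb n).
Proof. by move=> w; apply/asboolP; exact: braid_eq_refl. Qed.

Lemma braid_eqb_sym n : symmetric (@braid_eqb n).
Proof.
by move=> v w; apply/asboolP/asboolP => h; exact: braid_eq_sym.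
Qed.

Lemma braid_eqb_trans n : transitive (@braid_eqb n).
Proof.
move=> v u w /asboolP h1 /asboolP h2; apply/asboolP.
exact: braid_eq_trans h1 h2.
Qed.

Canonical braid_equiv n :=
  EquivRel (@braid_eqb n) (@braid_eqb_refl n) (@braid_eqb_sym n)
           (@braid_eqb_trans n).

Local Open Scope quotient_scope.

Definition braid_quot (n : nat) := {eq_quot (@braid_equiv n)}.

HB.instance Definition _ n := Choice.on (braid_quot n).

(* Here [N] is the number of strands. *)
Definition braid_group (N : nat) : Type := braid_quot N.-1.

HB.instance Definition _ N := Choice.on (braid_group N).

Definition braid_of (N : nat) (w : braid_word N.-1) : braid_group N :=
  \pi_(braid_quot N.-1) w.

Definition word_of (N : nat) (g : braid_group N) : braid_word N.-1 :=
  repr (g : braid_quot N.-1).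

Lemma word_ofK N (g : braid_group N) : braid_of (word_of g) = g.
Proof. exact: reprK. Qed.

Lemma braid_of_eq N (v w : braid_word N.-1) :
  braid_of v = braid_of w <-> braid_eq v w.
Proof.
split=> [h|h].
  by apply/asboolP; move/eqmodP: h.
by apply/eqmodP; apply/asboolP.
Qed.

Lemma braid_ofK N (w : braid_word N.-1) : braid_eq (word_of (braid_of w)) w.
Proof. by apply/braid_of_eq; rewrite word_ofK. Qed.

Lemma word_inv_cat n (v w : braid_word n) :
  word_inv (v ++ w) = word_inv w ++ word_inv v.
Proof. by rewrite /word_inv map_cat rev_cat. Qed.

Lemma flip_letterK n : involutive (@flip_letter n).
Proof. by case=> i b; rewrite /flip_letter /= negbK. Qed.

Lemma word_invK n : involutive (@word_inv n).
Proof.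
by move=> w; rewrite /word_inv map_rev revK -map_comp map_id_in // => x _;
   exact: flip_letterK.
Qed.

Lemma braid_eq_mulV n (w : braid_word n) : braid_eq (w ++ word_inv w) [::].
Proof.
elim: w => [|x w IH]; first exact: braid_eq_refl.
rewrite -cat1s word_inv_cat catA -(catA _ w).
apply: (@braid_eq_trans _ _ ([:: x] ++ [::] ++ word_inv [:: x])).
  rewrite -catA; apply: braid_eq_cat; first exact: braid_eq_refl.
  by apply: braid_eq_cat; [exact: IH | exact: braid_eq_refl].
exact: braid_eq_cancel.
Qed.

Lemma braid_eq_Vmul n (w : braid_word n) : braid_eq (word_inv w ++ w) [::].
Proof. by have := braid_eq_mulV (word_inv w); rewrite word_invK. Qed.

Lemma braid_eq_inv n (v w : braid_word n) :
  braid_eq v w -> braid_eq (word_inv v) (word_inv w).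
Proof.
move=> h; set v' := word_inv v; set w' := word_inv w.
apply: (@braid_eq_trans _ _ (v' ++ (w ++ w'))).
  rewrite -{1}(cats0 v'); apply: braid_eq_cat; first exact: braid_eq_refl.
  by apply: braid_eq_sym; exact: braid_eq_mulV.
rewrite catA -[X in braid_eq _ X](cat0s w').
apply: braid_eq_cat; last exact: braid_eq_refl.
apply: (@braid_eq_trans _ _ (v' ++ v)); last exact: braid_eq_Vmul.
by apply: braid_eq_cat; [exact: braid_eq_refl | exact: braid_eq_sym].
Qed.

Section BraidGroup.
Variable N : nat.
Implicit Types g h : braid_group N.

Definition braid_one : braid_group N := braid_of [::].
Definition braid_mul g h : braid_group N := braid_of (word_of g ++ word_of h).
Definition braid_inv g : braid_group N := braid_of (word_inv (word_of g)).

Lemma braid_of_cat v w :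
  braid_of (v ++ w) = braid_mul (braid_of v) (braid_of w).
Proof.
by apply/braid_of_eq; apply: braid_eq_cat; apply: braid_eq_sym;
   exact: braid_ofK.
Qed.

Lemma braid_of_inv w : braid_of (word_inv w) = braid_inv (braid_of w).
Proof.
by apply/braid_of_eq; apply: braid_eq_inv; apply: braid_eq_sym; exact: braid_ofK.
Qed.

Lemma braid_mulA : associative braid_mul.
Proof.
move=> x y z.
by rewrite -[x]word_ofK -[y]word_ofK -[z]word_ofK -!braid_of_cat catA.
Qed.

Lemma braid_mul1 : left_id braid_one braid_mul.
Proof. by move=> x; rewrite -[x]word_ofK -braid_of_cat. Qed.

Lemma braid_mulr1 : right_id braid_one braid_mul.
Proof. by move=> x; rewrite -[x]word_ofK -braid_of_cat cats0. Qed.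

Lemma braid_mulVg : left_inverse braid_one braid_inv braid_mul.
Proof.
move=> x; rewrite -[x]word_ofK -braid_of_inv -braid_of_cat.
by apply/braid_of_eq; exact: braid_eq_Vmul.
Qed.

Lemma braid_mulgV : right_inverse braid_one braid_inv braid_mul.
Proof.
move=> x; rewrite -[x]word_ofK -braid_of_inv -braid_of_cat.
by apply/braid_of_eq; exact: braid_eq_mulV.
Qed.

HB.instance Definition _ := isGroup.Build (braid_group N)
  braid_mulA braid_mul1 braid_mulr1 braid_mulVg braid_mulgV.

(* The generator sigma_{i+1}. *)
Definition sigma (i : 'I_N.-1) : braid_group N := braid_of [:: (i, true)].

(* Meaningful on representatives because the defining relations are symmetric:
   see [mirror_braid_of]. *)
Definition mirror_braid g : braid_group N :=
  braid_of (map (@flip_letter N.-1) (word_of g)).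

End BraidGroup.

Lemma braid_eq_flip n (v w : braid_word n) :
  braid_eq v w -> braid_eq (map (@flip_letter n) v) (map (@flip_letter n) w).
Proof.
elim=> {v w} [w|v w _ h|u v w _ h1 _ h2|v v' w w' _ h1 _ h2|x|i j ij|i j ij].
- exact: braid_eq_refl.
- exact: braid_eq_sym.
- exact: braid_eq_trans h1 h2.
- by rewrite !map_cat; exact: braid_eq_cat.
- exact: braid_eq_cancel.
- by apply: braid_eq_sym; exact: (braid_eq_inv (braid_eq_far ij)).
- exact: (braid_eq_inv (braid_eq_braid ij)).
Qed.

Lemma mirror_braid_of N (w : braid_word N.-1) :
  mirror_braid (braid_of w : braid_group N) = braid_of (map (@flip_letter _) w).
Proof. by apply/braid_of_eq/braid_eq_flip; exact: braid_ofK. Qed.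

Definition mirror_if (N : nat) (b : bool) (g : braid_group N) : braid_group N :=
  if b then mirror_braid g else g.

Definition zpow (G : groupType) (x : G) (z : int) : G :=
  match z with
  | Posz m => (x ^+ m)%g
  | Negz m => (x ^- m.+1)%g
  end.

Section GeometricBraids.
Variable R : realType.
Local Notation space := (R * R * R)%type.

Definition isotopic (L L' : set space) : Prop :=
  exists H : R -> space -> space,
    [/\ {within [set u : R * space | 0 <= u.1 <= 1],
          continuous (fun u : R * space => H u.1 u.2)},
        forall s, 0 <= s <= 1 -> exists G : space -> space,
          [/\ continuous (H s), continuous G, cancel (H s) G & cancel G (H s)],
        H 0 =1 id
      & H 1 @` L = L'].

Variable N : nat.

(* A strand is a map t |-> (y, z); a family of strands is considered over
   [a, a + 1]. *)
Implicit Type f : 'I_N -> R -> R * R.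

Definition geometric_braid f (a : R) : Prop :=
  [/\ forall k, {within `[a, a + 1], continuous (f k)},
      forall t, a <= t <= a + 1 -> injective (f ^~ t)
    & exists s : 'I_N -> 'I_N,
        injective s /\ forall k, f k (a + 1) = f (s k) a].

(* The interval [a, a + 1] is wrapped around the vertical axis, y becoming the
   radial coordinate around the circle of radius 2. *)
Definition around_axis (t : R) (yz : R * R) : space :=
  ((2 + yz.1) * cos (2 * pi * t), (2 + yz.1) * sin (2 * pi * t), yz.2).

Definition braid_closure f (a : R) : set space :=
  [set P | exists k t, a <= t <= a + 1 /\ P = around_axis t (f k t)].

Definition crossing_value f (a t : R) : Prop :=
  a <= t <= a + 1 /\ exists k l, k != l /\ (f k t).1 = (f l t).1.

Definition no_endpoint_crossing f (a : R) : Prop :=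
  ~ crossing_value f a a /\ ~ crossing_value f a (a + 1).

(* At time t strand k goes through strand l, from larger to smaller y. *)
Definition crosses_down f (t : R) (k l : 'I_N) : Prop :=
  [/\ (f k t).1 = (f l t).1,
      \forall s \near t^'-, (f l s).1 < (f k s).1
    & \forall s \near t^'+, (f k s).1 < (f l s).1].

(* Only transverse double points, none of them at the endpoints. *)
Definition regular_projection f (a : R) : Prop :=
  no_endpoint_crossing f a /\
  forall t k l, a <= t <= a + 1 -> k != l -> (f k t).1 = (f l t).1 ->
    (crosses_down f t k l \/ crosses_down f t l k) /\
    forall m, (f m t).1 = (f k t).1 -> m = k \/ m = l.

(* Strands are counted from the largest y: the crossing involves the strands
   in positions i + 1 and i + 2 when exactly i strands lie above it. *)
Definition crossing_at f (t : R) (i : nat) (k l : 'I_N) : Prop :=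
  crosses_down f t k l /\ #|[pred m | (f k t).1 < (f m t).1]| = i.

(* Convention: a crossing is positive when the strand going from larger to
   smaller y has the larger z. The opposite one yields mirror images. *)
Definition crossing_exponent f (t : R) (i : nat) : int :=
  if `[< exists k l, crossing_at f t i k l /\ (f l t).2 < (f k t).2 >] then 1
  else if `[< exists k l, crossing_at f t i k l /\ (f k t).2 < (f l t).2 >]
  then -1 else 0.

(* The braid formed by the crossing points above t. For a regular projection
   they involve disjoint pairs of adjacent positions, so the order of the
   product does not matter. It is 1 if t is not a crossing value. *)
Definition crossing_factor f (t : R) : braid_group N :=
  (\prod_(i < N.-1) zpow (@sigma N i) (crossing_exponent f t i))%g.

Definition braid_reads f (a : R) (g : braid_group N) : Prop :=
  regular_projection f a /\
  exists ts : seq R,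
    [/\ sorted <%R ts, forall t, t \in ts <-> crossing_value f a t
      & g = (\prod_(t <- ts) crossing_factor f t)%g].

(* The condition y > -2 makes the closure embedded around the vertical axis. *)
Definition represented_by (L : set space) (g : braid_group N) : Prop :=
  exists f a,
    [/\ geometric_braid f a,
        forall k t, a <= t <= a + 1 -> -2 < (f k t).1,
        braid_reads f a g
      & isotopic L (braid_closure f a)].

End GeometricBraids.

Section LissajousToric.
Variable R : realType.
Variables N q p : nat.

Definition toric_curve (phi t : R) : R * R * R :=
  ((2 + sin (q%:R * t)) * cos (N%:R * t),
   (2 + sin (q%:R * t)) * sin (N%:R * t),
   cos (p%:R * (t + phi))).

Definition toric_knot (phi : R) : set (R * R * R) :=
  toric_curve phi @` `[0, 2 * pi].

(* The velocity never vanishes (N > 0), so singular means having a multiple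
   point. *)
Definition critical_phase (phi : R) : Prop :=
  exists s t, [/\ 0 <= s < 2 * pi, 0 <= t < 2 * pi, s != t
                & toric_curve phi s = toric_curve phi t].

Definition toric_strands (phi : R) (k : 'I_N) (t : R) : R * R :=
  (sin (2 * pi * q%:R / N%:R * (t + k%:R)),
   cos (2 * pi * p%:R / N%:R * (t + k%:R + phi))).

(* The phase of the strands when the curve has phase phi: the angle of the
   curve is 2 * pi * (t + k) / N. *)
Definition rescale_phase (phi : R) : R := N%:R * phi / (2 * pi).

Variables A B : int.

Definition epsilon (i : nat) : int := (-1) ^ (p%:Z * B * i%:Z %/ N%:Z)%Z.

Definition lambda (k : nat) : int := (-1) ^ (2 * A * p%:Z * k%:Z %/ q%:Z)%Z.

Definition alpha : braid_group N :=
  (\prod_(i < N.-1 | ~~ odd i.+1) zpow (@sigma N i) (epsilon i.+1))%g.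

Definition beta : braid_group N :=
  (\prod_(i < N.-1 | odd i.+1) zpow (@sigma N i) (epsilon i.+1))%g.

Definition alpha_beta (k : nat) : braid_group N := if odd k then alpha else beta.

Definition Q_factors : seq (braid_group N) :=
  [seq zpow (alpha_beta k) (lambda k) | k <- iota 1 q.-1].

Definition Qinv_factors : seq (braid_group N) :=
  [seq zpow (alpha_beta k) (- lambda k) | k <- rev (iota 1 q.-1)].

Definition toric_Q : braid_group N := (\prod_(g <- Q_factors) g)%g.

Definition toric_braid : braid_group N :=
  (toric_Q * alpha * toric_Q^-1 * beta)%g.

Definition toric_factors : seq (braid_group N) :=
  Q_factors ++ [:: alpha] ++ Qinv_factors ++ [:: beta].

(* The k-th crossing value in [eta, 1 + eta] carries the (k + j)-th factor
   (cyclically), all factors being mirrored if b. If N <= 2 some of the factors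
   are empty products, and the corresponding t_k are not crossing values. *)
Definition factors_match (phi eta : R) (b : bool) (j : nat) : Prop :=
  let psi := toric_strands (rescale_phase phi) in
  exists ts : seq R,
    [/\ sorted <%R ts /\ size ts = (2 * q)%N,
        forall t, t \in ts -> eta < t < 1 + eta,
        forall t, crossing_value psi eta t -> t \in ts,
        (2 < N)%N -> forall t, t \in ts -> crossing_value psi eta t
      & forall k, (k < 2 * q)%N ->
          crossing_factor psi (nth 0 ts k) =
          mirror_if b (nth 1%g toric_factors ((k + j) %% (2 * q))%N)].

End LissajousToric.

(* Main.v *)
Require Import Defs.
From HB Require Import structures.
From mathcomp Require Import all_boot all_order all_algebra.
From mathcomp Require Import all_classical all_reals all_analysis.
From mathcomp Require Import ring lra zify.

Set Implicit Arguments.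
Unset Strict Implicit.
Unset Printing Implicit Defensive.

Import Order.TTheory GRing.Theory Num.Theory.
Import numFieldNormedType.Exports.
Local Open Scope classical_set_scope.
Local Open Scope ring_scope.

(** Put the N strands at time t on the circle, at the angles
    2 pi q (t + k) / N - pi / 2; their heights are the cosines of these
    angles.  The angles are equally spaced, so two heights can coincide only
    when the configuration is symmetric about the horizontal axis, that is at
    the times t_j = (N + 2 j) / (4 q), j an integer.  At time t_j the angles
    are the pi b / N with b = j modulo 2, and for each a = j modulo 2 between 1
    and N - 1 the strand at angle pi a / N goes down through the strand at
    angle - pi a / N ([meet_at]).  Exactly a - 1 strands lie above them
    ([meet_at_count]), so this crossing is the letter sigma_a: even j gives the
    generators of alpha, odd j those of beta.

    The sign of the crossing is read on z_k - z_l, a product of two sines.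
    Since B is an inverse of q modulo N and 2 N A = 1 modulo q, the sign of one
    sine depends only on a and equals epsilon(a), the sign of the other depends
    only on j, and the ambiguities modulo N and modulo q cancel because both
    carry the same parity ([meet_at_sign]).  With c = p (pi / (2 q) + phi) and
    n the integral part of q c / pi, the second sign is
    (-1)^[(2 A p j + n) / q].

    Choosing an odd j_0 = 2 y - 1 with n + 2 A p j_0 = q h turns it into
    (-1)^h lambda(j - j_0).  As lambda(q) = lambda(2 q) = 1 and
    lambda(2 q - k) = - lambda(k), the factors at the times t_(j_0 + k),
    k = 1, ..., 2 q, are those of Q alpha Q^-1 beta, up to a global mirror
    image decided by the parity of h ([nth_toric_factors],
    [crossing_factor_toric]).

    The phase is critical exactly when q c / pi is an integer and N > 1
    ([critical_phase_multiple], [critical_phaseE]); this is what makes the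
    sines above nonzero.  Finally the closure of the geometric braid is the
    curve itself ([toric_knot_closure]), so that a constant isotopy is enough. *)

(** * Mirror images and layers of commuting generators *)

Section BraidAlgebra.
Variable N : nat.
Implicit Types g h : braid_group N.

Lemma mirror_mul g h :
  mirror_braid (g * h)%g = (mirror_braid g * mirror_braid h)%g.
Proof.
rewrite -[g]word_ofK -[h]word_ofK -[(_ * _)%g]braid_of_cat.
by rewrite !mirror_braid_of map_cat braid_of_cat.
Qed.

Lemma mirror1 : mirror_braid (1%g : braid_group N) = 1%g.
Proof. by rewrite -[1%g]/(braid_one N) mirror_braid_of. Qed.

Lemma mirrorV g : mirror_braid (g^-1)%g = ((mirror_braid g)^-1)%g.
Proof.
apply/(mulgI (mirror_braid g)).
by rewrite -mirror_mul !mulgV mirror1.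
Qed.

Lemma mirror_if_prod (b : bool) (gs : seq (braid_group N)) :
  mirror_if b (\prod_(g <- gs) g)%g = (\prod_(g <- gs) mirror_if b g)%g.
Proof.
case: b => //=; elim: gs => [|g gs IH]; first by rewrite !big_nil mirror1.
by rewrite !big_cons mirror_mul IH.
Qed.

Lemma mirror_sigma (i : 'I_N.-1) : mirror_braid (sigma i) = ((sigma i)^-1)%g.
Proof. by rewrite mirror_braid_of -[RHS]braid_of_inv. Qed.

Lemma commute_sigma (i j : 'I_N.-1) :
  odd i = odd j -> commute (sigma i : braid_group N) (sigma j).
Proof.
have far (a b : 'I_N.-1) : (a.+1 < b)%N ->
    commute (sigma a : braid_group N) (sigma b).
  move=> ab; rewrite /commute /sigma.
  rewrite -[LHS]braid_of_cat -[RHS]braid_of_cat.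
  by apply/braid_of_eq; exact: braid_eq_far.
move=> oij; have [ij|ji|/val_inj->//] := ltngtP i j.
  by apply: far; lia.
by apply/commute_sym/far; lia.
Qed.

Lemma zpowN (G : groupType) (x : G) (z : int) : zpow x (- z) = ((zpow x z)^-1)%g.
Proof. by case: z => [[|n]|n] /=; rewrite ?expg0 ?invg1 ?invgK. Qed.

Lemma commute_zpow (G : groupType) (x y : G) (z : int) :
  commute x y -> commute x (zpow y z).
Proof.
by move=> xy; case: z => n /=; [|apply: commuteV]; exact: commuteX.
Qed.

Lemma mirror_zpow_sigma (i : 'I_N.-1) (z : int) :
  mirror_braid (zpow (sigma i : braid_group N) z) = zpow (sigma i) (- z).
Proof.
have mX m : mirror_braid (sigma i ^+ m : braid_group N)%g = ((sigma i)^-1 ^+ m)%g.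
  elim: m => [|m IH]; first by rewrite !expg0 mirror1.
  by rewrite !expgS mirror_mul IH mirror_sigma.
by rewrite zpowN; case: z => m /=; rewrite ?mirrorV mX expVgn.
Qed.

(** Only the values of [e] at the indices [i.+1] of parity [par] matter: [alpha]
    and [beta] are the even and odd layers with exponents [epsilon]. *)
Definition layer (par : bool) (e : nat -> int) : braid_group N :=
  (\prod_(i < N.-1 | odd i.+1 == par) zpow (sigma i) (e i.+1))%g.

Lemma mirror_layer par e : mirror_braid (layer par e) = layer par (fun i => - e i).
Proof.
rewrite /layer; elim/big_rec2: _ => [|i x y _ <-]; first exact: mirror1.
by rewrite mirror_mul mirror_zpow_sigma.
Qed.

(** Generators of the same parity commute, so a layer is inverted letter by
    letter; this is why its inverse is also its mirror image. *)
Lemma layerV par e : ((layer par e)^-1)%g = layer par (fun i => - e i).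
Proof.
suff : (layer par e * layer par (fun i => - e i) = 1)%g.
  by move=> h; apply/(mulgI (layer par e)); rewrite h mulgV.
rewrite /layer -prodgM_commute => [|i j /eqP i_par /eqP j_par].
  by rewrite big1 // => i _; rewrite zpowN mulgV.
apply/commute_zpow/commute_sym/commute_zpow/commute_sigma.
by move: i_par j_par => /=; do 2 case: odd => //=; case: par.
Qed.

End BraidAlgebra.

(** * The factors of the toric braid *)

Lemma signz_cases (z : int) : (-1 : int) ^ z = 1 \/ (-1 : int) ^ z = -1.
Proof.
by rewrite expN1r; case/boolP: (odd `|z|) => o;
  rewrite -signr_odd ?o ?(negbTE o); [right|left].
Qed.

Lemma signzD (y z : int) : (-1 : int) ^ (y + z) = (-1) ^ y * (-1) ^ z.
Proof. by apply: exprzDr; exact: unitrN1. Qed.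

Lemma signz_double (z : int) : (-1 : int) ^ (z + z) = 1.
Proof. by rewrite signzD; case: (signz_cases z) => ->. Qed.

(** The floor of - x is one less than the opposite of the floor of x when x is
    not an integer; the extra unit is the sign in [lambda_compl]. *)
Lemma divz_opp (m : int) (d : nat) : (0 < d)%N -> ~~ (d%:Z %| m)%Z ->
  ((- m) %/ d)%Z = - (m %/ d)%Z - 1.
Proof.
move=> d_gt0 ndm; have d0 : d%:Z != 0 by lia.
have r_ge0 : 0 <= (m %% d)%Z by rewrite modz_ge0.
have r_lt : (m %% d)%Z < d by apply: ltz_pmod; lia.
have r0 : (m %% d)%Z != 0 by apply: contra ndm => /eqP h; apply/dvdz_mod0P.
rewrite [X in (- X)](divz_eq m d).
have -> : - ((m %/ d)%Z * d + (m %% d)%Z) =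
  (- (m %/ d)%Z - 1) * d + (d%:Z - (m %% d)%Z) by ring.
rewrite divzMDl // [X in _ + X]divz_small ?addr0 //.
move: (m %% d)%Z r_ge0 r_lt r0 => r r_ge0 r_lt r0.
by apply/andP; split; lia.
Qed.

Section Factors.
Variables (N q p : nat) (A B : int).
Hypotheses (hq : (0 < q)%N) (hqodd : odd q) (hpq : coprime p q).
Hypothesis hAB : 2 * N%:Z * A + B * q%:Z = 1.

Lemma lambda_mod2q (k k' : nat) (c : int) : k%:Z = k'%:Z + c * (2 * q)%:Z ->
  lambda q p A k = lambda q p A k'.
Proof.
move=> e; have q0 : q%:Z != 0 by lia.
have e2 : 2 * A * p * k = (2 * A * p * c + 2 * A * p * c) * q + 2 * A * p * k'.
  by rewrite e; lia.
by rewrite /lambda e2 divzMDl // signzD signz_double mul1r.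
Qed.

Lemma lambda_q : lambda q p A q = 1.
Proof.
have q0 : q%:Z != 0 by lia.
rewrite /lambda mulzK //.
have -> : 2 * A * p = A * p + A * p by ring.
exact: signz_double.
Qed.

Lemma lambda_2q : lambda q p A (2 * q) = 1.
Proof. by rewrite (@lambda_mod2q _ 0 1) ?add0r ?mul1r // /lambda mulr0 div0z. Qed.

(** 2, A and p are invertible modulo q; the inverse of 2 A is N. *)
Lemma q_ndvd k : (0 < k < q)%N -> ~~ (q%:Z %| 2 * A * p * k)%Z.
Proof.
move=> /andP[k0 kq]; apply/negP => /dvdzP[c hc].
have : (q %| p * k)%N.
  suff : (q%:Z %| (p * k)%:Z)%Z by [].
  apply/dvdzP; exists (N%:Z * c + B * p * k).
  have -> : (N%:Z * c + B * p * k) * q = N%:Z * (c * q) + (B * q) * p * k by ring.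
  rewrite -hc; have -> : B * q = 1 - 2 * N%:Z * A by move: hAB; lia.
  by rewrite PoszM; ring.
rewrite Gauss_dvdr; last by rewrite coprime_sym.
by move/(dvdn_leq k0); lia.
Qed.

(** This antisymmetry makes the second half of the braid, Q^-1, the continuation
    of the sequence of exponents [lambda] beyond q. *)
Lemma lambda_compl k : (0 < k < q)%N ->
  lambda q p A (2 * q - k) = - lambda q p A k.
Proof.
move=> kq; have q0 : q%:Z != 0 by lia.
have e : 2 * A * p * (2 * q - k)%N =
    (2 * A * p + 2 * A * p) * q + - (2 * A * p * k).
  by rewrite -subzn ?PoszM; [ring|lia].
rewrite /lambda e divzMDl // divz_opp ?q_ndvd // signzD signz_double mul1r.
set u := (_ %/ _)%Z; rewrite signzD.
have -> : (-1 : int) ^ (- u) = (-1) ^ u by rewrite !expN1r abszN.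
by rewrite expN1r /= mulrN1.
Qed.

Lemma alphaE : alpha N p B = layer N false (epsilon N p B).
Proof. by apply: eq_bigl => i; rewrite eqbF_neg. Qed.

Lemma betaE : beta N p B = layer N true (epsilon N p B).
Proof. by apply: eq_bigl => i; rewrite eqb_id. Qed.

Lemma zpow_alpha_beta k (z : int) : z = 1 \/ z = -1 ->
  zpow (alpha_beta N p B k) z =
  layer N (~~ odd k) (fun i => z * epsilon N p B i).
Proof.
have -> : alpha_beta N p B k = layer N (~~ odd k) (epsilon N p B).
  by rewrite /alpha_beta alphaE betaE; case: odd.
case=> -> /=.
  by rewrite expg1; apply: eq_bigr => i _; rewrite mul1r.
by rewrite expg1 layerV; apply: eq_bigr => i _; rewrite mulN1r.
Qed.

Lemma lambda_cases k : lambda q p A k = 1 \/ lambda q p A k = -1.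
Proof. exact: signz_cases. Qed.

Lemma size_toric_factors : size (toric_factors N q p A B) = (2 * q)%N.
Proof. by rewrite !size_cat !size_map size_rev !size_iota /=; lia. Qed.

(** All 2 q factors obey a single formula: the two isolated factors alpha and
    beta are the values [lambda_q] and [lambda_2q], and the factors of Q^-1 are
    given by [lambda_compl].  The formula can be compared with the crossings,
    which are also indexed uniformly. *)
Lemma nth_toric_factors (m : nat) : (m < 2 * q)%N ->
  nth 1%g (toric_factors N q p A B) m =
  layer N (odd m) (fun i => lambda q p A m.+1 * epsilon N p B i).
Proof.
move=> m2q; rewrite /toric_factors nth_cat size_map size_iota.
have [mq|qm] := ltnP m q.-1.
  rewrite (nth_map 0%N) ?size_iota // nth_iota // add1n.
  by rewrite zpow_alpha_beta ?negbK //; exact: lambda_cases.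
have {qm} [r rE] : exists r, m = (r + q.-1)%N by exists (m - q.-1)%N; lia.
rewrite rE addnK; case: r rE => [|r] rE /=.
  rewrite prednK // lambda_q alphaE.
  have -> : odd q.-1 = false by lia.
  by apply: eq_bigr => i _; rewrite mul1r.
rewrite nth_cat size_map size_rev size_iota.
case: ltnP => [rq|qr].
  rewrite (nth_map 0%N) ?size_rev ?size_iota // nth_rev ?size_iota //.
  rewrite nth_iota ?add1n; last by lia.
  rewrite zpow_alpha_beta; last by case: (lambda_cases (q.-1 - r.+1).+1) => ->; [right|left].
  have -> : (r + q.-1).+2 = (2 * q - (q.-1 - r.+1).+1)%N by lia.
  rewrite lambda_compl; last by lia.
  by congr (layer _ _ _); lia.
have -> : r = q.-1 by lia.
rewrite subnn /=.
have -> : (q.-1 + q.-1).+2 = (2 * q)%N by lia.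
rewrite lambda_2q betaE.
have -> : ~~ odd (q.-1 + q.-1) by lia.
by apply: eq_bigr => i _; rewrite mul1r.
Qed.

Lemma toric_QV :
  ((toric_Q N q p A B)^-1)%g = (\prod_(g <- Qinv_factors N q p A B) g)%g.
Proof.
rewrite /toric_Q /Q_factors /Qinv_factors.
elim: (iota 1 q.-1) => [|k s IH]; first by rewrite !big_nil invg1.
rewrite rev_cons map_rcons -cats1 big_cat big_seq1 -IH /= big_cons.
by rewrite zpowN invgM.
Qed.

Lemma toric_braidE :
  toric_braid N q p A B = (\prod_(g <- toric_factors N q p A B) g)%g.
Proof.
rewrite /toric_factors !big_cat !big_seq1 -toric_QV /=.
by rewrite /toric_braid !mulgA.
Qed.

End Factors.

(** * Signs and zeros of sines *)

Section Trigonometry.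
Variable R : realType.
Implicit Types x y : R.

Lemma sgz_signzM (n : int) x : sgz (((-1 : int) ^ n)%:~R * x) = (-1) ^ n * sgz x.
Proof. by case: (signz_cases n) => ->; rewrite ?mul1r // mulN1r sgzN mulN1r. Qed.

Lemma sinD_intpi (n : int) x :
  sin (x + n%:~R * pi) = ((-1 : int) ^ n)%:~R * sin x.
Proof.
have nat_case (m : nat) y : sin (y + m%:R * pi) = ((-1 : int) ^ m%:Z)%:~R * sin y.
  elim: m => [|m IH]; first by rewrite mul0r addr0 mul1r.
  have -> : y + m.+1%:R * pi = (y + m%:R * pi) + pi by rewrite -natr1; ring.
  rewrite sinDpi IH intS signzD.
  by rewrite intrM -mulrA; exact: esym (mulN1r _).
case: (intP n) => [|m|m].
- by rewrite mul0r addr0 mul1r.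
- exact: nat_case.
- have := nat_case m.+1 (x + (- m.+1%:Z)%:~R * pi).
  have -> : x + (- m.+1%:Z)%:~R * pi + m.+1%:R * pi = x by rewrite mulrNz; ring.
  move=> ->; rewrite mulrA -intrM -signzD addNr /=.
  by rewrite expr0z mul1r.
Qed.

Lemma cosD_intpi (n : int) x :
  cos (x + n%:~R * pi) = ((-1 : int) ^ n)%:~R * cos x.
Proof. by rewrite -!sinDpihalf addrAC sinD_intpi. Qed.

Lemma sinD_int2pi (n : int) x : sin (x + n%:~R * (2 * pi)) = sin x.
Proof.
have -> : n%:~R * (2 * pi) = (n + n)%:~R * pi :> R by rewrite intrD; ring.
by rewrite sinD_intpi signz_double mul1r.
Qed.

Lemma cosD_int2pi (n : int) x : cos (x + n%:~R * (2 * pi)) = cos x.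
Proof. by rewrite -!sinDpihalf addrAC sinD_int2pi. Qed.

Lemma sgz_sin (n : int) x : n%:~R * pi < x < (n + 1)%:~R * pi ->
  sgz (sin x) = (-1) ^ n.
Proof.
rewrite intrD => /andP[nx xn].
have -> : x = (x - n%:~R * pi) + n%:~R * pi by ring.
rewrite sinD_intpi sgz_signzM gtr0_sgz ?mulr1 // sin_gt0_pi //.
by apply/andP; split; lra.
Qed.

Lemma sin_eq0_int x : sin x = 0 -> exists n : int, x = n%:~R * pi.
Proof.
move=> x0; have pi0 : 0 < pi :> R := pi_gt0 R.
exists (Num.floor (x / pi)); apply/eqP; rewrite eq_le.
have /andP[lo hi] := floor_itv (x / pi).
rewrite ler_pdivlMr // in lo; rewrite ltr_pdivrMr // in hi.
rewrite lo andbT leNgt; apply/negP => lo'.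
have := @sgz_sin (Num.floor (x / pi)) x.
by rewrite lo' hi x0 sgz0 => /(_ isT); case: (signz_cases (Num.floor (x / pi))) => ->.
Qed.

Lemma cos_eq0_int x : cos x = 0 -> exists n : int, x = pi / 2 + n%:~R * pi.
Proof.
rewrite -sinDpihalf => /sin_eq0_int[n xE]; exists (n - 1).
by rewrite intrB; lra.
Qed.

Lemma subr_sin x y : sin x - sin y = 2 * (cos ((x + y) / 2) * sin ((x - y) / 2)).
Proof.
have -> : sin x = sin ((x + y) / 2 + (x - y) / 2) by congr sin; field.
have -> : sin y = sin ((x + y) / 2 - (x - y) / 2) by congr sin; field.
by rewrite sinD sinB; ring.
Qed.

Lemma subr_cos x y :
  cos x - cos y = - (2 * (sin ((x + y) / 2) * sin ((x - y) / 2))).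
Proof.
have -> : cos x = cos ((x + y) / 2 + (x - y) / 2) by congr cos; field.
have -> : cos y = cos ((x + y) / 2 - (x - y) / 2) by congr cos; field.
by rewrite cosD cosB; ring.
Qed.

(** The argument lies between floor (m / d) pi and the next multiple of pi, the
    remainder of m modulo d being at most d - 1. *)
Lemma sgz_sin_frac (m : int) (d : nat) (c : R) : (0 < d)%N ->
    0 <= c < pi / d%:R -> (c == 0 -> ~~ (d%:Z %| m)%Z) ->
  sgz (sin (pi * m%:~R / d%:R + c)) = (-1) ^ (m %/ d%:Z)%Z.
Proof.
move=> d0 /andP[c0 cd] c0_ndm; apply: sgz_sin.
have pi0 : 0 < pi :> R := pi_gt0 R.
have dR : 0 < d%:R :> R by rewrite ltr0n.
have mE := divz_eq m d; have r0 : 0 <= (m %% d)%Z by rewrite modz_ge0 //; lia.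
have rd : (m %% d)%Z < d by apply: ltz_pmod; lia.
have rc0 : (c == 0) -> (m %% d)%Z != 0.
  by move/c0_ndm; apply: contra => /eqP h; apply/dvdz_mod0P.
set u := (m %/ d)%Z in mE *; set r := (m %% d)%Z in mE r0 rd rc0.
have -> : pi * m%:~R / d%:R = u%:~R * pi + pi / d%:R * r%:~R :> R.
  rewrite mE. by rewrite intrD intrM; field; rewrite gt_eqF.
set e := pi / d%:R in cd *; have e0 : 0 < e by rewrite divr_gt0.
have pE : pi = e * d%:R by rewrite /e; field; rewrite gt_eqF.
have rdR : r%:~R + 1 <= d%:R :> R.
  by rewrite -[d%:R]/(d%:Z%:~R) -[1]/(1%:~R) -intrD ler_int; lia.
have er0 : 0 <= e * r%:~R by apply: mulr_ge0; [exact: ltW | rewrite ler0z].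
rewrite intrD; apply/andP; split.
  have [cE|cN] := eqVneq c 0; last first.
    have : 0 < c by rewrite lt_neqAle eq_sym cN.
    by lra.
  have : 0 < e * r%:~R by apply: mulr_gt0 => //; rewrite ltr0z lt_neqAle eq_sym rc0 ?cE.
  by lra.
have : e * (r%:~R + 1) <= e * d%:R by rewrite ler_pM2l.
by rewrite -pE; lra.
Qed.

Lemma sgz_sin_frac0 (m : int) (d : nat) : (0 < d)%N -> ~~ (d%:Z %| m)%Z ->
  sgz (sin (pi * m%:~R / d%:R : R)) = (-1) ^ (m %/ d%:Z)%Z.
Proof.
move=> d0 ndm; rewrite -[X in sin X]addr0 sgz_sin_frac // lexx.
by rewrite divr_gt0 ?pi_gt0 ?ltr0n.
Qed.

Lemma sin_frac_neq0 (m : int) (d : nat) : (0 < d)%N -> ~~ (d%:Z %| m)%Z ->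
  sin (pi * m%:~R / d%:R : R) != 0.
Proof.
by move=> d0 ndm; rewrite -sgz_eq0 sgz_sin_frac0 //; case: (signz_cases (m %/ d)%Z) => ->.
Qed.

End Trigonometry.

(** * Crossings of the projected strands *)

Lemma ndvdz_small (d : nat) (z : int) : z != 0 -> - d%:Z < z < d%:Z ->
  ~~ (d%:Z %| z)%Z.
Proof.
move=> z0 zd; apply/negP => /dvdzP[b bE]; move: z0 zd; rewrite bE => z0 zd.
have [b1|b1] : b >= 1 \/ b <= -1.
- have : b != 0 by apply: contra z0 => /eqP->; rewrite mul0r.
  by lia.
- by nia.
- by nia.
Qed.

Lemma natr_neq0 (R : realType) (d : nat) : (0 < d)%N -> d%:R != 0 :> R.
Proof. by rewrite pnatr_eq0 lt0n. Qed.

(** Distinct strands stay distinct modulo N after multiplication by q or p. *)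
Lemma N_ndvd_mul (N c : nat) (k l : 'I_N) : coprime N c -> k != l ->
  ~~ (N%:Z %| c%:Z * (k%:Z - l%:Z))%Z.
Proof.
move=> Nc kl; rewrite Gauss_dvdzr //; apply: ndvdz_small.
  by move: kl; rewrite -val_eqE /=; lia.
by have := ltn_ord k; have := ltn_ord l; lia.
Qed.

Section Crossings.
Variables (R : realType) (N q p : nat) (phi : R).
Hypotheses (hN : (0 < N)%N) (hq : (0 < q)%N) (hNq : coprime N q).

Local Notation psi := (@toric_strands R N q p (rescale_phase N phi)).

(** The time t_j; see [strand_height] for the angles of the strands at t_j. *)
Definition crossing_time (j : int) : R := (N%:R + 2 * j%:~R) / (4 * q%:R).

(** At the j-th crossing time the strands k and l are at the angles pi a / N and
    - pi a / N modulo 2 pi, with k on the way down.  The angles are compared as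
    integers modulo 2 N. *)
Definition meet_at (j : int) (a : nat) (k l : 'I_N) : Prop :=
  (0 < a < N)%N /\
  exists u v : int, j + 2 * (q%:Z * k%:Z) = a%:Z + 2 * (N%:Z * u) /\
                    j + 2 * (q%:Z * l%:Z) = - a%:Z + 2 * (N%:Z * v).

(** The angle of strand k at time t_j is pi (j + 2 q k) / N, and all angles move
    at the common speed 2 pi q / N. *)
Lemma strand_height (j : int) (k : 'I_N) (s : R) (a u : int) :
    j + 2 * (q%:Z * k%:Z) = a + 2 * (N%:Z * u) ->
  (psi k s).1 =
  cos (pi * a%:~R / N%:R + 2 * pi * q%:R / N%:R * (s - crossing_time j)).
Proof.
move=> e; rewrite /= -cosBpihalf.
have eR : j%:~R + 2 * (q%:R * k%:R) = a%:~R + 2 * (N%:R * u%:~R) :> R.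
  by have := congr1 (fun z : int => z%:~R : R) e; rewrite !(intrD, intrM).
rewrite -[RHS](cosD_int2pi u); congr cos.
have -> : a%:~R = j%:~R + 2 * (q%:R * k%:R) - 2 * (N%:R * u%:~R) :> R by lra.
by rewrite /crossing_time; field; rewrite (natr_neq0 _ hN) (natr_neq0 _ hq).
Qed.

(** A difference of two sines is a product of a cosine of the half sum and a sine
    of the half difference.  The latter is nonzero for distinct strands, and the
    former vanishes only at the times t_j. *)
Lemma equal_heights_meet (k l : 'I_N) (t : R) :
    k != l -> (psi k t).1 = (psi l t).1 ->
  exists (j : int) (a : nat),
    t = crossing_time j /\ (meet_at j a k l \/ meet_at j a l k).
Proof.
move=> kl /eqP; rewrite -subr_eq0 /= subr_sin => /eqP.
set x := (X in cos X); set y := (X in sin X).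
have yE : y = pi * (q%:Z * (k%:Z - l%:Z))%:~R / N%:R.
  by rewrite /y intrM intrB /=; field; rewrite (natr_neq0 _ hN).
have ndvd := N_ndvd_mul hNq kl.
move/eqP; rewrite !mulf_eq0 pnatr_eq0 /= yE (negbTE (sin_frac_neq0 R hN ndvd)).
rewrite orbF => /eqP /cos_eq0_int[M xE].
pose j := N%:Z * M - q%:Z * (k%:Z + l%:Z).
have pi0 : pi != 0 :> R by rewrite gt_eqF // pi_gt0.
have tE : t = crossing_time j.
  rewrite /crossing_time /j intrB !intrM intrD /=.
  have : x * N%:R / pi = (pi / 2 + M%:~R * pi) * N%:R / pi by rewrite xE.
  rewrite /x => e.
  have -> : t = ((2 * pi * q%:R / N%:R * (t + k%:R) +
                  2 * pi * q%:R / N%:R * (t + l%:R)) / 2 *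
    N%:R / pi) / (2 * q%:R) - (k%:R + l%:R) / 2.
    (* pi is generalized, as its definition by choice would be unfolded by field *)
    move: pi0; move: (@pi R) => P P0.
    by field; rewrite (natr_neq0 _ hN) (natr_neq0 _ hq) P0.
  rewrite e; move: pi0; move: (@pi R) => P P0.
  by field; rewrite (natr_neq0 _ hq) P0.
have N0 : (2 * N%:Z) != 0 by lia.
pose d := q%:Z * (k%:Z - l%:Z).
have := divz_eq (N%:Z * M + d) (2 * N%:Z).
have := modz_ge0 (N%:Z * M + d) N0.
have : ((N%:Z * M + d) %% (2 * N%:Z))%Z < 2 * N%:Z by apply: ltz_pmod; lia.
set e := (_ %% _)%Z; set u := (_ %/ _)%Z => e_lt e_ge eE.
have eN0 : e != 0.
  apply: contra ndvd => /eqP e0; apply/dvdzP; exists (2 * u - M).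
  by rewrite -/d; move: eE; rewrite e0; lia.
have eNN : e != N%:Z.
  apply: contra ndvd => /eqP e0; apply/dvdzP; exists (2 * u + 1 - M).
  by rewrite -/d; move: eE; rewrite e0; lia.
(* e is the angle of k modulo 2 N: in the upper half k goes down through l,
   in the lower half l goes down through k. *)
exists j; case: (lerP e N%:Z) => eN.
  exists `|e|%N; split=> //; left; split; first by lia.
  exists u, (M - u); rewrite /j gez0_abs //.
  by move: eE; rewrite /d => eE; split; lia.
exists (absz (2 * N%:Z - e)%R); split=> //; right; split; first by lia.
exists (M - u - 1), (u + 1); rewrite /j gez0_abs; last by lia.
by move: eE; rewrite /d => eE; split; lia.
Qed.

Lemma meet_at_heights (j : int) (a : nat) (k l : 'I_N) : meet_at j a k l ->
  (psi k (crossing_time j)).1 = (psi l (crossing_time j)).1.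
Proof.
case=> _ [u [v [ku lv]]].
rewrite (strand_height _ ku) (strand_height _ lv).
by rewrite subrr mulr0 !addr0 -cosN mulrNz; congr cos; ring.
Qed.

Lemma meet_at_neq j a (k l : 'I_N) : meet_at j a k l -> k != l.
Proof.
case=> aN [u [v [ku]]]; apply: contra_eqN => /eqP<-; apply/eqP.
rewrite ku => e; have {}e : a%:Z = N%:Z * (v - u) by lia.
by have [z1|z1] : v - u >= 1 \/ v - u <= 0; [lia|nia|nia].
Qed.

Lemma sum_below (n a : nat) : (0 < a)%N ->
  (\sum_(0 <= i < n | 0 < i < a) 1)%N = (minn n a).-1.
Proof.
move=> a0; elim: n => [|n IH]; first by rewrite big_geq // min0n.
by rewrite big_mkcond big_nat_recr //= -big_mkcond IH; case: ifP; lia.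
Qed.

(** Here [rho m] is the position of strand m on the circle, counted from strand
    l in steps of 2 pi / N.  The difference of heights of m and k is then
    2 sin (pi rho / N) sin (pi (a - rho) / N), so that the strands above the
    crossing are those on the arc from l to k. *)
Lemma meet_at_rank (j : int) (a : nat) (k l : 'I_N) : meet_at j a k l ->
  exists rho : 'I_N -> 'I_N,
    [/\ injective rho, rho k = a :> nat, rho l = 0%N :> nat,
        forall m, ((psi k (crossing_time j)).1 < (psi m (crossing_time j)).1) =
                  (0 < rho m < a)%N
      & forall m, (psi m (crossing_time j)).1 = (psi k (crossing_time j)).1 ->
                  rho m = a :> nat \/ rho m = 0%N :> nat].
Proof.
case=> aN [u [v [ku lv]]].
pose w (m : 'I_N) : int := ((q%:Z * (m%:Z - k%:Z) + a%:Z) %% N%:Z)%Z.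
have N0 : N%:Z != 0 by lia.
have w_ge m : 0 <= w m by rewrite modz_ge0.
have w_lt m : w m < N by apply: ltz_pmod; lia.
have ltw m : (`|w m| < N)%N by have := w_lt m; have := w_ge m; lia.
pose rho m := Ordinal (ltw m).
have rhoE m : (rho m)%:Z = w m by rewrite /= gez0_abs.
have sgE m : sgz ((psi m (crossing_time j)).1 - (psi k (crossing_time j)).1) =
    if (0 < rho m < a)%N then 1 else
    if (rho m == 0 :> nat)%N || (rho m == a :> nat)%N then 0 else -1.
  have [c cE] : exists c : int, q%:Z * (m%:Z - k%:Z) + a%:Z = c * N%:Z + (rho m)%:Z.
    by rewrite rhoE /w; exists ((q%:Z * (m%:Z - k%:Z) + a%:Z) %/ N%:Z)%Z; exact: divz_eq.
  rewrite (strand_height _ ku).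
  rewrite (@strand_height j m _ (2 * (rho m)%:Z - a%:Z) (u + c)); last by lia.
  rewrite subrr mulr0 !addr0 subr_cos -mulrN -mulrN -sinN.
  have -> : (pi * (2 * (rho m)%:Z - a%:Z)%:~R / N%:R + pi * a%:Z%:~R / N%:R) / 2 =
      pi * (rho m)%:Z%:~R / N%:R :> R.
    by rewrite intrB intrM; field; rewrite (natr_neq0 _ hN).
  have -> : - ((pi * (2 * (rho m)%:Z - a%:Z)%:~R / N%:R - pi * a%:Z%:~R / N%:R) / 2) =
      pi * (a%:Z - (rho m)%:Z)%:~R / N%:R :> R.
    by rewrite !intrB intrM; field; rewrite (natr_neq0 _ hN).
  have rN := ltn_ord (rho m).
  rewrite !sgzM gtr0_sgz // mul1r.
  have [r0|r0] := eqVneq (rho m : nat) 0%N; first by rewrite r0 mulr0 mul0r sin0 sgz0 mul0r.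
  have -> : sgz (sin (pi * (rho m)%:Z%:~R / N%:R : R)) = 1.
    rewrite sgz_sin_frac0 //; last by apply: ndvdz_small; lia.
    by rewrite divz_small //; lia.
  rewrite mul1r orFb; have [ra|ra] := eqVneq (rho m : nat) a.
    by rewrite ra subrr mulr0 mul0r sin0 sgz0 ltnn andbF.
  rewrite sgz_sin_frac0 //; last by apply: ndvdz_small; lia.
  case: ifP => ra'; first by rewrite divz_small //; lia.
  have -> : a%:Z - (rho m)%:Z = (-1) * N%:Z + (N%:Z + a%:Z - (rho m)%:Z) by ring.
  by rewrite divzMDl // divz_small //; lia.
exists rho; split.
- move=> m m' /(congr1 val) /= e; apply/eqP/negP => /negP mm'.
  move/negP: (N_ndvd_mul hNq mm'); apply.
  have e' : w m = w m' by rewrite -(rhoE m) -(rhoE m') /= e.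
  have := divz_eq (q%:Z * (m%:Z - k%:Z) + a%:Z) N%:Z.
  have := divz_eq (q%:Z * (m'%:Z - k%:Z) + a%:Z) N%:Z.
  rewrite -/(w m) -/(w m') e'; set b := (_ %/ _)%Z; set b' := (_ %/ _)%Z => h h'.
  by apply/dvdzP; exists (b' - b); lia.
- by rewrite /= /w subrr mulr0 add0r modz_small //; lia.
- rewrite /= /w; suff -> : q%:Z * (l%:Z - k%:Z) + a%:Z = (v - u) * N%:Z by rewrite modzMl.
  by lia.
- by move=> m; rewrite -subr_gt0 -sgz_gt0 sgE; case: ifP => // _; case: ifP.
- move=> m e; move: (sgE m); rewrite e subrr sgz0.
  case: ifP => [_ /eqP//|_]; case: ifP => [/orP[/eqP h|/eqP h] _|_ /eqP//].
    by right.
  by left.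
Qed.

Lemma meet_at_count (j : int) (a : nat) (k l : 'I_N) : meet_at j a k l ->
  #|[pred m | (psi k (crossing_time j)).1 < (psi m (crossing_time j)).1]| = a.-1.
Proof.
move=> M; have [aN _] := M.
have [rho [rho_inj _ _ rho_lt _]] := meet_at_rank M.
rewrite -sum1_card; transitivity (\sum_(m < N | 0 < rho m < a) 1)%N.
  by apply: eq_bigl => m; rewrite inE rho_lt.
transitivity (\sum_(i < N | 0 < i < a) 1)%N; first by rewrite [RHS](reindex_inj rho_inj).
by rewrite -(big_mkord (fun i => (0 < i < a)%N) (fun=> 1%N)) sum_below; lia.
Qed.

Lemma meet_at_triple (j : int) (a : nat) (k l m : 'I_N) : meet_at j a k l ->
  (psi m (crossing_time j)).1 = (psi k (crossing_time j)).1 -> m = k \/ m = l.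
Proof.
move=> M; have [rho [rho_inj rk rl _ rho_eq]] := meet_at_rank M.
by move/rho_eq; case=> e; [left|right]; apply/rho_inj/val_inj; rewrite /= e.
Qed.

(** The two angles are opposite at t_j and move together, so the difference of
    heights is a product of sines in which only one factor depends on time. *)
Lemma meet_at_heights_diff (j : int) (a : nat) (k l : 'I_N) (s : R) :
    meet_at j a k l ->
  exists2 c : R, 0 < c & (psi l s).1 - (psi k s).1 =
    c * sin (2 * pi * q%:R / N%:R * (s - crossing_time j)).
Proof.
move=> [/andP[a0 aN] [u [v [ku lv]]]].
have pi0 : 0 < pi :> R := pi_gt0 R.
exists (2 * sin (pi * a%:Z%:~R / N%:R)).
  rewrite mulr_gt0 // sin_gt0_pi // divr_gt0 ?mulr_gt0 ?ltr0n //=.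
  by rewrite ltr_pdivrMr ?ltr0n // ltr_pM2l // ltr_nat.
rewrite (strand_height _ ku) (strand_height _ lv).
set e := 2 * pi * q%:R / N%:R * (s - crossing_time j).
rewrite subr_cos mulrNz; set x := pi * a%:Z%:~R / N%:R.
have -> : (pi * - a%:Z%:~R / N%:R + e + (x + e)) / 2 = e.
  by rewrite /x; field; rewrite (natr_neq0 _ hN).
have -> : (pi * - a%:Z%:~R / N%:R + e - (x + e)) / 2 = - x.
  by rewrite /x; field; rewrite (natr_neq0 _ hN).
by rewrite sinN; ring.
Qed.

(** Within h = N / (2 q) of t_j the moving angle stays in the open interval from
    - pi to pi, where the sign of its sine is that of the time difference. *)
Lemma meet_at_crosses_down (j : int) (a : nat) (k l : 'I_N) : meet_at j a k l ->
  crosses_down psi (crossing_time j) k l.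
Proof.
move=> M; set t := crossing_time j; set h : R := N%:R / (2 * q%:R).
have h0 : 0 < h by rewrite divr_gt0 ?mulr_gt0 ?ltr0n.
have pi0 : 0 < pi :> R := pi_gt0 R.
have ang s : 2 * pi * q%:R / N%:R * (s - t) = pi * ((s - t) / h).
  by rewrite /h; field; rewrite (natr_neq0 _ hN) (natr_neq0 _ hq).
split; first exact: meet_at_heights M.
- near=> s; have [c c0] := meet_at_heights_diff s M.
  rewrite -subr_lt0 -/t ang => ->; rewrite pmulr_rlt0 // -oppr_gt0 -sinN.
  have st : s < t by near: s; exact: nbhs_left_lt.
  have sh : t - h < s by near: s; apply: nbhs_left_gt; rewrite ltrBlDr ltrDl.
  have e0 : 0 < (t - s) / h by rewrite divr_gt0 // subr_gt0.
  rewrite -mulrN -mulNr opprB sin_gt0_pi // mulr_gt0 //=.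
  by rewrite gtr_pMr // ltr_pdivrMr //; lra.
- near=> s; have [c c0] := meet_at_heights_diff s M.
  rewrite -subr_gt0 -/t ang => ->; rewrite pmulr_rgt0 //.
  have st : t < s by near: s; exact: nbhs_right_gt.
  have sh : s < t + h by near: s; apply: nbhs_right_lt; rewrite ltrDl.
  have e0 : 0 < (s - t) / h by rewrite divr_gt0 // subr_gt0.
  rewrite sin_gt0_pi // mulr_gt0 //=.
  by rewrite gtr_pMr // ltr_pdivrMr //; lra.
Unshelve. all: by end_near.
Qed.

Lemma crosses_down_asym (f : 'I_N -> R -> R * R) (t : R) (k l : 'I_N) :
  crosses_down f t k l -> ~ crosses_down f t l k.
Proof.
move=> [_ kl _] [_ lk _].
have [s [lt1 lt2]] := @filter_ex _ _ (at_left_proper_filter t) _ (filterI kl lk).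
by have := lt_trans lt1 lt2; rewrite ltxx.
Qed.

Lemma meet_at_crossing (j : int) (a : nat) (k l : 'I_N) : meet_at j a k l ->
  crossing_at psi (crossing_time j) a.-1 k l.
Proof.
by move=> M; split; [exact: meet_at_crosses_down M | exact: meet_at_count M].
Qed.

Lemma crossing_at_meet (t : R) (i : nat) (k l : 'I_N) : crossing_at psi t i k l ->
  exists j : int, t = crossing_time j /\ meet_at j i.+1 k l.
Proof.
move=> [C cnt]; have kl : k != l.
  by apply: contra_notN (crosses_down_asym C) => /eqP kl; rewrite kl -{1}kl.
have [yE _ _] := C; have [j [a [tE [M|M]]]] := equal_heights_meet kl yE.
  have [aN _] := M; exists j; split=> //; suff -> : i.+1 = a by [].
  by rewrite -cnt tE (meet_at_count M); lia.
by case: (crosses_down_asym C); rewrite tE; exact: meet_at_crosses_down M.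
Qed.

End Crossings.

(** * Signs of the crossings *)

(** B is the inverse of q modulo N. *)
Lemma q_inverse (N q : nat) (A B c : int) : (0 < N)%N ->
    2 * N%:Z * A + B * q%:Z = 1 ->
  exists (k : 'I_N) (u : int), q%:Z * k%:Z = c + N%:Z * u.
Proof.
move=> hN hAB; have N0 : N%:Z != 0 by lia.
have ge0 : 0 <= ((B * c) %% N)%Z by rewrite modz_ge0.
have ltN : ((B * c) %% N)%Z < N by apply: ltz_pmod; lia.
have e := divz_eq (B * c) N.
move: (_ %% _)%Z (_ %/ _)%Z ge0 ltN e => r d r0 rN e.
have rN' : (`|r| < N)%N by lia.
exists (Ordinal rN'), (- (2 * A * c) - q%:Z * d) => /=.
rewrite gez0_abs //.
have -> : r = B * c - d * N by rewrite e; ring.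
have -> : q%:Z * (B * c - d * N) = (B * q%:Z) * c - q%:Z * d * N%:Z by ring.
have -> : B * q%:Z = 1 - 2 * N%:Z * A by move: hAB; lia.
by ring.
Qed.

(** Every a of the parity of j between 1 and N - 1 is reached, because the
    equation q k = (a - j) / 2 modulo N is solvable, and likewise for - a. *)
Lemma meet_at_exists (N q : nat) (A B j z : int) (a : nat) : (0 < N)%N ->
    2 * N%:Z * A + B * q%:Z = 1 -> (0 < a < N)%N -> a%:Z = j + 2 * z ->
  exists k l : 'I_N, meet_at q j a k l.
Proof.
move=> hN hAB aN az; have [k [u ku]] := q_inverse z hN hAB.
have [l [v lv]] := q_inverse (z - a%:Z) hN hAB.
by exists k, l; split=> //; exists u, v; rewrite ku lv; split; lia.
Qed.

Section CrossingSigns.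
Variables (R : realType) (N q p : nat) (phi : R) (A B : int).
Hypotheses (hN : (0 < N)%N) (hq : (0 < q)%N) (hqodd : odd q).
Hypotheses (hpq : coprime p q) (hNq : coprime N q) (hNp : coprime N p).
Hypothesis hAB : 2 * N%:Z * A + B * q%:Z = 1.

Local Notation psi := (@toric_strands R N q p (rescale_phase N phi)).
Local Notation time := (crossing_time R N q).

Lemma crossing_time_inj : injective time.
Proof.
move=> i j; have q0 := natr_neq0 R hq.
move/(congr1 (fun x => x * (4 * q%:R))).
rewrite /crossing_time !divfK ?mulf_neq0 ?pnatr_eq0 -?lt0n //.
by move/addrI/(mulfI (_ : 2%:R != 0)) => /(_ _)/intr_inj; apply; rewrite pnatr_eq0.
Qed.

(** Both half angles are reduced with the Bezout relation: k - l = B a + N w and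
    u + v = 2 A j + q W.  The signs (-1)^(p w) and (-1)^(p W) appear, and W + w is
    even, so that they cancel. *)
Lemma meet_at_sign (n : int) (c : R) (j : int) (a : nat) (k l : 'I_N) :
    p%:R * (pi / (2 * q%:R) + phi) = pi * n%:~R / q%:R + c ->
    0 < c < pi / q%:R -> meet_at q j a k l ->
  sgz ((psi k (time j)).2 - (psi l (time j)).2) =
  - (epsilon N p B a * (-1) ^ ((2 * A * p%:Z * j + n) %/ q%:Z)%Z).
Proof.
move=> phase /andP[c0 cq] M; have kl := meet_at_neq hN hq hNq M.
have [aN [u [v [ku lv]]]] := M.
have N0Z : N%:Z != 0 by lia.
have q0Z : q%:Z != 0 by lia.
rewrite /= subr_cos sgzN; congr (- _); rewrite sgzM gtr0_sgz // mul1r sgzM.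
set X := (X in sin X); set Y := (Y in _ * sgz (sin Y)).
have YE : Y = pi * (p%:Z * (k%:Z - l%:Z))%:~R / N%:R.
  by rewrite /Y intrM intrB /=; field; rewrite (natr_neq0 _ hN).
have XE : X = pi * (p%:Z * (u + v) + n)%:~R / q%:R + c.
  have : N%:Z * (u + v) = j + q%:Z * (k%:Z + l%:Z) by lia.
  move/(congr1 (fun z : int => z%:~R : R)); rewrite intrM !intrD intrM intrD => e.
  have kE : j%:~R = N%:R * (u%:~R + v%:~R) - q%:R * (k%:R + l%:R) :> R.
    by rewrite e /=; ring.
  rewrite intrM intrD mulrDr mulrDl -addrA -phase /X /rescale_phase /crossing_time kE.
  have := pi_gt0 R => /gt_eqF/negbT; move: (@pi R) => P P0.
  by field; rewrite (natr_neq0 _ hN) (natr_neq0 _ hq) P0.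
rewrite YE XE sgz_sin_frac0 ?(N_ndvd_mul hNp kl) // sgz_sin_frac //; first last.
- by move=> /eqP c0'; move: c0; rewrite c0' ltxx.
- by rewrite (ltW c0).
pose w := 2 * A * (k%:Z - l%:Z) + B * (u - v).
pose W := 2 * A * (k%:Z + l%:Z) + B * (u + v).
have klE : p%:Z * (k%:Z - l%:Z) = (p%:Z * w) * N%:Z + p%:Z * B * a%:Z.
  have -> : a%:Z = q%:Z * (k%:Z - l%:Z) - N%:Z * (u - v) by lia.
  have -> : p%:Z * w * N%:Z + p%:Z * B * (q%:Z * (k%:Z - l%:Z) - N%:Z * (u - v)) =
    p%:Z * (2 * N%:Z * A + B * q%:Z) * (k%:Z - l%:Z) by rewrite /w; ring.
  by rewrite hAB; ring.
have uvE : p%:Z * (u + v) + n = (p%:Z * W) * q%:Z + (2 * A * p%:Z * j + n).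
  have -> : j = N%:Z * (u + v) - q%:Z * (k%:Z + l%:Z) by lia.
  have -> : p%:Z * W * q%:Z +
    (2 * A * p%:Z * (N%:Z * (u + v) - q%:Z * (k%:Z + l%:Z)) + n) =
    p%:Z * (2 * N%:Z * A + B * q%:Z) * (u + v) + n by rewrite /W; ring.
  by rewrite hAB; ring.
rewrite klE uvE !divzMDl // !signzD /epsilon.
have : (-1 : int) ^ (p%:Z * W) * (-1) ^ (p%:Z * w) = 1.
  rewrite -signzD.
  have -> : p%:Z * W + p%:Z * w = p%:Z * (2 * A * k%:Z + B * u) +
     p%:Z * (2 * A * k%:Z + B * u) by rewrite /W /w; ring.
  exact: signz_double.
by move=> h; rewrite mulrACA h mul1r mulrC.
Qed.

Lemma no_crossing_factor (t : R) :
  (forall k l, k != l -> (psi k t).1 <> (psi l t).1) -> crossing_factor psi t = 1%g.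
Proof.
move=> nc; rewrite /crossing_factor big1 // => i _.
have no P : ~ (exists k l, crossing_at psi t i k l /\ P k l).
  move=> [k [l [C _]]]; have [j [tE /(meet_at_neq hN hq hNq) kl]] := crossing_at_meet hN hq hNq C.
  by case: C => -[/(nc _ _ kl)].
by rewrite /crossing_exponent !asboolF.
Qed.

(** All the crossings counted by the exponent have the same sign, whichever pair
    of strands is chosen, and there is one exactly when the parities agree. *)
Lemma crossing_exponent_time (n : int) (c : R) (j z : int) (m : nat) (i : 'I_N.-1) :
    p%:R * (pi / (2 * q%:R) + phi) = pi * n%:~R / q%:R + c ->
    0 < c < pi / q%:R -> j = m%:Z + 2 * z ->
  crossing_exponent psi (time j) i =
  if odd i.+1 == odd m
  then - (epsilon N p B i.+1 * (-1) ^ ((2 * A * p%:Z * j + n) %/ q%:Z)%Z)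
  else 0.
Proof.
move=> phase cq jE.
have inv k l : crossing_at psi (time j) i k l -> meet_at q j i.+1 k l.
  by move/(crossing_at_meet hN hq hNq) => [j' [/crossing_time_inj<-]].
case: ifPn => par; last first.
  have no P : ~ (exists k l, crossing_at psi (time j) i k l /\ P k l).
    move=> [k [l [/inv[_ [u [v [ku _]]]] _]]]; move/negP: par; apply; apply/eqP.
    by move: ku; rewrite jE; lia.
  by rewrite /crossing_exponent !asboolF.
set s := - _.
have sE k l : crossing_at psi (time j) i k l ->
    sgz ((psi k (time j)).2 - (psi l (time j)).2) = s.
  by move/inv; exact: meet_at_sign phase cq.
have [k [l M]] : exists k l : 'I_N, meet_at q j i.+1 k l.
  have iN := ltn_ord i.
  have [y yE] : exists y : int, i.+1%:Z = m%:Z + 2 * y.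
    exists ((i.+1./2)%:Z - (m./2)%:Z); move: par => /eqP.
    by have := odd_double_half i.+1; have := odd_double_half m; lia.
  by apply: (meet_at_exists (z := y - z) hN hAB); [lia | rewrite jE yE; lia].
have C : crossing_at psi (time j) i k l := meet_at_crossing p phi hN hq hNq M.
have : s = 1 \/ s = -1.
  rewrite /s /epsilon -signzD.
  by case: (signz_cases ((p%:Z * B * i.+1%:Z %/ N%:Z)%Z +
    ((2 * A * p%:Z * j + n) %/ q%:Z)%Z)) => ->; [right|left].
rewrite /crossing_exponent => -[s1|s1]; rewrite s1 in sE *.
  rewrite asboolT //; exists k, l; split=> //.
  by rewrite -subr_gt0 -sgz_gt0 sE.
rewrite asboolF; last first.
  by move=> [k' [l' [/sE e]]]; rewrite -subr_gt0 -sgz_gt0 e.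
rewrite asboolT //; exists k, l; split=> //.
by rewrite -subr_lt0 -sgz_lt0 sE.
Qed.

Lemma trivial_braid_group (g : braid_group N) : (N <= 1)%N -> g = 1%g.
Proof.
move=> N1; rewrite -[g]word_ofK; case: (word_of g) => [//|[[i iN] b] w].
by exfalso; move: iN; lia.
Qed.

(** The phase is constrained only for 1 < N, because a curve with a single strand
    has no crossing and no critical phase. *)
Lemma crossing_factor_toric (n : int) (c : R) (y h e : int) (m : nat) :
    ((1 < N)%N -> p%:R * (pi / (2 * q%:R) + phi) = pi * n%:~R / q%:R + c /\
                  0 < c < pi / q%:R) ->
    n + 2 * A * p%:Z * (2 * y - 1) = q%:Z * h -> (m < 2 * q)%N ->
  crossing_factor psi (time (2 * y + m%:Z + e * (2 * q)%:Z)) =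
  mirror_if (~~ odd `|h|) (nth 1%g (toric_factors N q p A B) m).
Proof.
move=> phase nh m2q.
have [N1|N1] := leqP N 1; first by rewrite [LHS]trivial_braid_group // [RHS]trivial_braid_group.
have {phase}[phase cq] := phase N1.
rewrite (nth_toric_factors hq hqodd hpq hAB m2q).
set j := 2 * y + _ + _.
have q0 : q%:Z != 0 by lia.
have jE : j = m%:Z + 2 * (y + e * q%:Z) by rewrite /j; lia.
have sE : (-1 : int) ^ ((2 * A * p%:Z * j + n) %/ q%:Z)%Z =
   (-1) ^ h * lambda q p A m.+1.
  have -> : 2 * A * p%:Z * j + n =
    (h + (2 * A * p%:Z * e + 2 * A * p%:Z * e)) * q%:Z + 2 * A * p%:Z * m.+1%:Z.
    have -> : n = q%:Z * h - 2 * A * p%:Z * (2 * y - 1) by rewrite -nh; ring.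
    by rewrite /j PoszM intS; ring.
  by rewrite divzMDl // signzD (signzD h) signz_double mulr1.
transitivity (layer N (odd m) (fun i => - ((-1) ^ h * (lambda q p A m.+1 * epsilon N p B i)))).
  rewrite /crossing_factor /layer [RHS]big_mkcond /=; apply: eq_bigr => i _.
  rewrite (crossing_exponent_time i phase cq jE) // sE; case: ifP => // _.
  by congr (zpow _ _); ring.
rewrite expN1r -signr_odd; case: (odd `|h|); rewrite /= ?mirror_layer.
  by apply: eq_bigr => i _; congr (zpow _ _); ring.
by apply: eq_bigr => i _; congr (zpow _ _); ring.
Qed.

End CrossingSigns.

(** * The curve, its strands and its critical phases *)

Section CurveAndBraid.
Variables (R : realType) (N q p : nat) (phi : R).
Hypotheses (hN : (0 < N)%N) (hq : (0 < q)%N) (hp : (0 < p)%N).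
Hypotheses (hpq : coprime p q) (hNq : coprime N q) (hNp : coprime N p).

Local Notation psi := (@toric_strands R N q p (rescale_phase N phi)).
Local Notation curve := (toric_curve N q p phi).

Lemma toric_curve_periodic (s : R) (z : int) : curve (s + z%:~R * (2 * pi)) = curve s.
Proof.
have mulE (d : nat) (x : R) :
    d%:R * (x + z%:~R * (2 * pi)) = d%:R * x + (d%:Z * z)%:~R * (2 * pi).
  by rewrite intrM /=; ring.
have -> : curve (s + z%:~R * (2 * pi)) =
  ((2 + sin (q%:R * (s + z%:~R * (2 * pi)))) * cos (N%:R * (s + z%:~R * (2 * pi))),
   (2 + sin (q%:R * (s + z%:~R * (2 * pi)))) * sin (N%:R * (s + z%:~R * (2 * pi))),
   cos (p%:R * (s + phi + z%:~R * (2 * pi)))) by rewrite /toric_curve (addrAC s).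
by rewrite !mulE !sinD_int2pi !cosD_int2pi.
Qed.

Lemma toric_curve_strand (t : R) (k : 'I_N) :
  curve (2 * pi * (t + k%:R) / N%:R) = around_axis t (psi k t).
Proof.
rewrite /toric_curve /around_axis /=.
have -> : N%:R * (2 * pi * (t + k%:R) / N%:R) = 2 * pi * t + k%:Z%:~R * (2 * pi) :> R.
  by field; rewrite (natr_neq0 _ hN).
rewrite cosD_int2pi sinD_int2pi.
have -> : q%:R * (2 * pi * (t + k%:R) / N%:R) = 2 * pi * q%:R / N%:R * (t + k%:R) :> R.
  by field; rewrite (natr_neq0 _ hN).
congr (_, _, cos _); rewrite /rescale_phase.
have := pi_gt0 R => /gt_eqF/negbT; move: (@pi R) => P P0.
by field; rewrite (natr_neq0 _ hN) P0.
Qed.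

Lemma reduce_angle (s : R) : exists z : int, 0 <= s + z%:~R * (2 * pi) < 2 * pi.
Proof.
have pi0 : 0 < 2 * pi :> R by rewrite mulr_gt0 // pi_gt0.
exists (- Num.floor (s / (2 * pi))).
have /andP[] := floor_itv (s / (2 * pi)).
rewrite ler_pdivlMr // ltr_pdivrMr // mulrNz intrD mulrDl mul1r => lo hi.
by apply/andP; split; lra.
Qed.

Lemma critical_phase_of_coincidence (s t : R) : curve s = curve t ->
  (forall z : int, s - t <> z%:~R * (2 * pi)) -> critical_phase N q p phi.
Proof.
move=> e st; have [y ys] := reduce_angle s; have [z zt] := reduce_angle t.
exists (s + y%:~R * (2 * pi)), (t + z%:~R * (2 * pi)); split=> //.
  by apply/eqP => h; apply: (st (z - y)); rewrite intrB; lra.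
by rewrite !toric_curve_periodic.
Qed.

Lemma noncritical_strands (t : R) : ~ critical_phase N q p phi ->
  injective (psi ^~ t).
Proof.
move=> nc k l kl; apply/eqP/negP => /negP kNl; apply: nc.
apply: (@critical_phase_of_coincidence (2 * pi * (t + k%:R) / N%:R)
  (2 * pi * (t + l%:R) / N%:R)).
  by rewrite !toric_curve_strand kl.
move=> z zE; have := N_ndvd_mul (coprimen1 N) kNl; rewrite mul1r => /negP; apply.
apply/dvdzP; exists z; apply: (@intr_inj R).
rewrite intrM intrB /=.
have := pi_gt0 R => /gt_eqF/negbT pi0; have N0 := natr_neq0 R hN.
apply: (mulfI (_ : 2 * pi / N%:R != 0)).
  by rewrite !mulf_neq0 ?invr_eq0.
have -> : 2 * pi / N%:R * (z%:~R * N%:R) = z%:~R * (2 * pi) :> R by field; rewrite ?N0 ?q0.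
by rewrite -zE; field.
Qed.

(** A double point at the two parameters sigma / 2 + pi / N and
    sigma / 2 - pi / N: their difference is a period of the angle around the
    axis, the choice of sigma equates the radii, and the Bezout relation between
    p and q allows equating the third coordinates as well. *)
Lemma critical_phase_multiple (n : int) : (1 < N)%N ->
  p%:R * (pi / (2 * q%:R) + phi) = pi * n%:~R / q%:R -> critical_phase N q p phi.
Proof.
move=> N1 cE.
have [[u v] /= uv] : exists uv : int * int, uv.1 * p%:Z + uv.2 * q%:Z = 1.
  by apply/coprimezP.
pose m := - (n * u); pose n' := n * v.
have nE : n' * q%:Z - p%:Z * m = n.
  by rewrite /n' /m -[RHS]mulr1 -uv; ring.
have N0 := natr_neq0 R hN; have q0 := natr_neq0 R hq.
have pi0 := pi_gt0 R.
pose sigma : R := pi * (1 + 2 * m%:~R) / q%:R.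
apply: (@critical_phase_of_coincidence (sigma / 2 + pi / N%:R) (sigma / 2 - pi / N%:R)).
  rewrite /toric_curve.
  have -> : sin (q%:R * (sigma / 2 + pi / N%:R)) = sin (q%:R * (sigma / 2 - pi / N%:R)).
    apply/eqP; rewrite -subr_eq0 subr_sin.
    have -> : (q%:R * (sigma / 2 + pi / N%:R) + q%:R * (sigma / 2 - pi / N%:R)) / 2
        = pi / 2 + m%:~R * pi by rewrite /sigma; field; rewrite q0 N0.
    by rewrite cosD_intpi cos_pihalf mulr0 mul0r mulr0.
  have -> : N%:R * (sigma / 2 + pi / N%:R) =
      N%:R * (sigma / 2 - pi / N%:R) + 1%:~R * (2 * pi) by field; rewrite ?N0 ?q0.
  rewrite cosD_int2pi sinD_int2pi; congr (_, _, _).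
  apply/eqP; rewrite -subr_eq0 subr_cos.
  have -> : (p%:R * (sigma / 2 + pi / N%:R + phi) + p%:R * (sigma / 2 - pi / N%:R + phi)) / 2
      = 0 + n'%:~R * pi.
    have -> : (p%:R * (sigma / 2 + pi / N%:R + phi) + p%:R * (sigma / 2 - pi / N%:R + phi)) / 2
      = p%:R * (pi / (2 * q%:R) + phi) + p%:R * pi * m%:~R / q%:R.
      by rewrite /sigma; field; rewrite q0 N0.
    rewrite cE -nE intrB !intrM /=; by field; rewrite ?N0 ?q0.
  by rewrite sinD_intpi sin0 mulr0 mul0r mulr0 oppr0.
move=> z zE.
have : 1 = z%:~R * N%:R :> R.
  have -> : z%:~R = (z%:~R * (2 * pi)) / (2 * pi) :> R.
    by rewrite mulfK // gt_eqF // mulr_gt0.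
  rewrite -zE; move: pi0 => /gt_eqF/negbT; move: (@pi R) (sigma) => P s P0.
  by field; rewrite N0 P0.
rewrite -[1]/(1%:~R) -[N%:R]/(N%:Z%:~R) -intrM => /intr_inj zN.
by have [z1|z1] : z >= 1 \/ z <= 0; [lia|nia|nia].
Qed.

(** At a double point the parameters differ by a multiple 2 pi r / N of the period
    of the angle; equality of radii and of third coordinates then determines
    their sum in two ways, and comparing them gives the phase. *)
Lemma critical_phaseE : critical_phase N q p phi ->
  exists n : int, p%:R * (pi / (2 * q%:R) + phi) = pi * n%:~R / q%:R.
Proof.
move=> [s [t [/andP[s0 s2] /andP[t0 t2] st]]]; rewrite /toric_curve => -[xE yE zE].
have N0 := natr_neq0 R hN; have q0 := natr_neq0 R hq.
have pi0 := pi_gt0 R.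
have rs : 0 < 2 + sin (q%:R * s) by have := sin_geN1 (q%:R * s); lra.
have rt : 0 < 2 + sin (q%:R * t) by have := sin_geN1 (q%:R * t); lra.
have radE : 2 + sin (q%:R * s) = 2 + sin (q%:R * t).
  apply/eqP; rewrite -(eqrXn2 (n := 2)) ?ltW //; apply/eqP.
  have polar (r x : R) : r ^+ 2 = (r * cos x) ^+ 2 + (r * sin x) ^+ 2.
    by rewrite !exprMn -mulrDr cos2Dsin2 mulr1.
  by rewrite (polar _ (N%:R * s)) xE yE -polar.
rewrite radE in xE yE.
move: xE => /(mulfI (lt0r_neq0 rt)) cosE; move: yE => /(mulfI (lt0r_neq0 rt)) sinE.
have : cos (N%:R * s - N%:R * t) - cos 0 = 0.
  by rewrite cosB cosE sinE -!expr2 cos2Dsin2 cos0 subrr.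
move/eqP; rewrite subr_cos addr0 subr0 oppr_eq0.
rewrite !mulf_eq0 pnatr_eq0 /= orbb => /eqP/sin_eq0_int[r rE].
have ndvd (d : nat) : coprime N d -> ~~ (N%:Z %| d%:Z * r)%Z.
  move=> Nd; rewrite Gauss_dvdzr //; apply/negP => /dvdzP[b bE].
  have stE : s - t = b%:~R * (2 * pi).
    have : (N%:R * s - N%:R * t) / 2 * (2 / N%:R) = r%:~R * pi * (2 / N%:R) by rewrite rE.
    rewrite bE intrM /=.
    have -> : (N%:R * s - N%:R * t) / 2 * (2 / N%:R) = s - t by field; rewrite ?N0 ?q0.
    by move=> ->; field.
  have b1 : b < 1 by rewrite -(ltr_int R) -(ltr_pM2r (_ : 0 < 2 * pi)) ?mulr_gt0 //; lra.
  have b2 : - 1 < b by rewrite -(ltr_int R) -(ltr_pM2r (_ : 0 < 2 * pi)) ?mulr_gt0 //; lra.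
  move/negP: st; apply; rewrite -subr_eq0 stE (_ : b = 0) ?mul0r //; lia.
have halfdiff (d : nat) : (d%:R * s - d%:R * t) / 2 = pi * (d%:Z * r)%:~R / N%:R.
  have -> : (d%:R * s - d%:R * t) / 2 = d%:R / N%:R * ((N%:R * s - N%:R * t) / 2).
    by field; rewrite ?N0 ?q0.
  by rewrite rE intrM /=; field.
have : sin (q%:R * s) = sin (q%:R * t) by lra.
move/eqP; rewrite -subr_eq0 subr_sin halfdiff !mulf_eq0 pnatr_eq0 /=.
rewrite (negbTE (sin_frac_neq0 R hN (ndvd _ hNq))) orbF => /eqP/cos_eq0_int[m mE].
move/eqP: zE; rewrite -subr_eq0 subr_cos oppr_eq0.
have -> : (p%:R * (s + phi) - p%:R * (t + phi)) / 2 = pi * (p%:Z * r)%:~R / N%:R.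
  by rewrite -halfdiff; congr (_ / _); ring.
rewrite !mulf_eq0 pnatr_eq0 /=.
rewrite (negbTE (sin_frac_neq0 R hN (ndvd _ hNp))) orbF => /eqP/sin_eq0_int[n' nE].
exists (n' * q%:Z - p%:Z * m).
have -> : p%:R * (pi / (2 * q%:R) + phi) = p%:R * pi / (2 * q%:R) +
   (p%:R * (s + phi) + p%:R * (t + phi)) / 2 - p%:R / q%:R * ((q%:R * s + q%:R * t) / 2).
  by field; rewrite ?N0 ?q0.
by rewrite nE mE intrB !intrM /=; field.
Qed.

(** The parameter 2 pi (t + k) / N of the curve runs over a full period when t
    runs over [a, a + 1] and k over the strands. *)
Lemma toric_knot_closure (a : R) : toric_knot N q p phi = braid_closure psi a.
Proof.
have N0 := natr_neq0 R hN; have pi0 := pi_gt0 R.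
apply/seteqP; split => P /=.
  move=> [s _ <-].
  set x := N%:R * s / (2 * pi); set d := Num.floor (x - a).
  have /andP[lo hi] := floor_itv (x - a); rewrite -/d intrD in lo hi.
  have NZ0 : N%:Z != 0 by lia.
  have dE := divz_eq d N.
  have r0 : 0 <= (d %% N)%Z by rewrite modz_ge0.
  have rN : (d %% N)%Z < N by apply: ltz_pmod; lia.
  move: (d %/ N)%Z (d %% N)%Z dE r0 rN => z r dE r0 rN.
  have rN' : (`|r| < N)%N by lia.
  exists (Ordinal rN'), (x - d%:~R); split.
    by apply/andP; split; lra.
  rewrite -toric_curve_strand /= -[RHS](toric_curve_periodic _ z); congr toric_curve.
  have -> : `|r|%:R = d%:~R - z%:~R * N%:R :> R.
    by rewrite -[LHS]/((Posz _)%:~R) gez0_abs // dE intrD intrM addrAC subrr add0r.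
  rewrite /x; move: pi0 => /gt_eqF/negbT; move: (@pi R) => c c0.
  by field; rewrite N0 c0.
move=> [k [t [_ ->]]]; rewrite -toric_curve_strand.
set s := 2 * pi * (t + k%:R) / N%:R.
have [z /andP[z0 z2]] := reduce_angle s.
exists (s + z%:~R * (2 * pi)); last exact: toric_curve_periodic.
by rewrite /= in_itv /= z0 ltW.
Qed.

Lemma isotopic_refl (L : set (R * R * R)) : isotopic L L.
Proof.
exists (fun _ => id); split=> //; last exact: image_id.
  by apply: continuous_subspaceT => u; exact: cvg_snd.
by move=> s _; exists id; split=> //= u; exact: cvg_id.
Qed.

Lemma strand_next (k : 'I_N) (t : R) : psi k (t + 1) = psi (ordS k) t.
Proof.
have N0 := natr_neq0 R hN.
rewrite /toric_strands /=.
have [kN|Nk] := ltnP k.+1 N.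
  by rewrite modn_small // -natr1; congr (sin (_ * _), cos (_ * _)); ring.
have kE : k.+1 = N by have := ltn_ord k; lia.
have kR : k%:R = N%:R - 1 :> R by apply/eqP; rewrite eq_sym subr_eq natr1 kE.
have -> : (k.+1 %% N = 0)%N by rewrite [X in (X %% _)%N]kE modnn.
rewrite kR; congr (_, _).
  rewrite -[RHS](sinD_int2pi q%:Z); congr sin; by field; rewrite ?N0 ?q0.
rewrite -[RHS](cosD_int2pi p%:Z); congr cos; by field; rewrite ?N0 ?q0.
Qed.

Lemma toric_geometric_braid (a : R) : ~ critical_phase N q p phi ->
  geometric_braid psi a.
Proof.
move=> nc; split.
- move=> k; apply: continuous_subspaceT => t.
  have affine (b c d : R) : continuous (fun s : R => b * (s + c + d)).
    move=> s; apply: cvgMl_tmp.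
    by apply: cvgD; [apply: cvgD; [exact: cvg_id | exact: cvg_cst] | exact: cvg_cst].
  have affine0 (b c : R) : continuous (fun s : R => b * (s + c)).
    by move=> s; apply: cvgMl_tmp; apply: cvgD; [exact: cvg_id | exact: cvg_cst].
  have cs := continuous_comp (@affine0 (2 * pi * q%:R / N%:R) k%:R t) (@continuous_sin R _).
  have cc := continuous_comp (@affine (2 * pi * p%:R / N%:R) k%:R (rescale_phase N phi) t)
    (@continuous_cos R _).
  exact: (@cvg_pair _ _ _ _ _ _ (nbhs_filter t) (nbhs_filter _) (nbhs_filter _) _ _ cs cc).
- by move=> t _; exact: noncritical_strands.
- by exists (@ordS N); split; [exact: ordS_inj | move=> k; exact: strand_next].
Qed.

Lemma toric_regular (a : R) : no_endpoint_crossing psi a -> regular_projection psi a.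
Proof.
move=> nec; split=> // t k l _ kl e.
have [j [a' [-> [M|M]]]] := equal_heights_meet hN hq hNq kl e.
  split; first by left; exact: meet_at_crosses_down M.
  by move=> m; exact: meet_at_triple M.
split; first by right; exact: meet_at_crosses_down M.
move=> m me; have := meet_at_triple hN hq hNq M (phi := phi) (m := m) (p := p).
rewrite me (meet_at_heights p phi hN hq M) => /(_ erefl).
by case; [right|left].
Qed.

End CurveAndBraid.

(** * Reading the braid between two crossing times *)

Section Reading.
Variables (R : realType) (N q p : nat) (phi : R) (A B : int).
Hypotheses (hN : (0 < N)%N) (hq : (0 < q)%N) (hp : (0 < p)%N) (hqodd : odd q).
Hypotheses (hpq : coprime p q) (hNq : coprime N q) (hNp : coprime N p).
Hypothesis hAB : 2 * N%:Z * A + B * q%:Z = 1.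

Local Notation psi := (@toric_strands R N q p (rescale_phase N phi)).
Local Notation time := (crossing_time R N q).
Local Notation factors := (toric_factors N q p A B).

Lemma time_add (i k : int) : time (i + k) = time i + k%:~R / (2 * q%:R).
Proof. by rewrite /crossing_time intrD; field; rewrite (natr_neq0 _ hq). Qed.

Lemma time_period (i e : int) : time (i + e * (2 * q)%:Z) = time i + e%:~R.
Proof.
by rewrite time_add intrM PoszM intrM /=; congr (_ + _); field; rewrite (natr_neq0 _ hq).
Qed.

Lemma time_lt (i j : int) : (time i < time j) = (i < j).
Proof.
rewrite /crossing_time ltr_pM2r; last by rewrite invr_gt0 mulr_gt0 // ltr0n.
by rewrite ltrD2l ltr_pM2l // ltr_int.
Qed.

(** The crossing times are 1 / (2 q) apart. *)
Lemma half_unit_time (i j : int) : time j <> time i - (4 * q%:R)^-1.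
Proof.
have q0 : 4 * q%:R != 0 :> R by rewrite mulf_neq0 // (natr_neq0 _ hq).
move/(congr1 (fun x => x * (4 * q%:R))).
rewrite mulrBl mulVf // /crossing_time !divfK // => e.
have : (2 * j + 1)%:~R = (2 * i)%:~R :> R by rewrite intrD !intrM; lra.
by move/intr_inj; lia.
Qed.

Lemma crossing_value_time (a t : R) : crossing_value psi a t -> exists j, t = time j.
Proof.
by move=> [_ [k [l [kl /(equal_heights_meet hN hq hNq kl)[j [b [-> _]]]]]]]; exists j.
Qed.

Lemma time_crossing_value (a : R) (j : int) : (2 < N)%N -> a <= time j <= a + 1 ->
  crossing_value psi a (time j).
Proof.
move=> N2 ja; split=> //.
have := divz_eq j 2; have := modz_ge0 j (_ : 2 != 0); have := @ltz_pmod j 2.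
move: (_ %/ _)%Z (_ %% _)%Z => z r /(_ isT) r2 /(_ isT) r0 jE.
have [k [l M]] : exists k l : 'I_N, meet_at q j (if r == 0 then 2%N else 1%N) k l.
  have [r0'|r1] := eqVneq r 0.
    by apply: (meet_at_exists (z := 1 - z) hN hAB); lia.
  by apply: (meet_at_exists (z := - z) hN hAB); lia.
exists k, l; split; first exact: (meet_at_neq hN hq hNq M).
exact: (meet_at_heights p phi hN hq M).
Qed.

Lemma between_times_no_crossing (a : R) (i : int) : time (i - 1) < a < time i ->
  no_endpoint_crossing psi a.
Proof.
move=> /andP[lo hi].
have no j : time j <> a.
  by move=> ja; move: lo hi; rewrite -ja !time_lt; lia.
split=> /crossing_value_time[j jE]; first exact: (no j).
apply: (no (j + (-1) * (2 * q)%:Z)); rewrite time_period -jE; ring.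
Qed.

(** The hypotheses allow [a] to be one of the times t_j at which no strands cross,
    which happens for N <= 2.  The list of the next 2 q times would then end at
    a + 1, outside the open interval; its last element, which carries a trivial
    factor, is moved to the left by half the distance between two times. *)
Lemma factors_match_toric (b : bool) (y i e : int) (j : nat) (a : R) :
    (forall (m : nat) (e' : int), (m < 2 * q)%N ->
       crossing_factor psi (time (2 * y + m%:Z + e' * (2 * q)%:Z)) =
       mirror_if b (nth 1%g factors m)) ->
    time (i - 1) <= a < time i -> i = 2 * y + j%:Z + e * (2 * q)%:Z ->
    no_endpoint_crossing psi a ->
  factors_match N q p A B phi a b j.
Proof.
move=> factorE /andP[lo hi] iE [nca nca1].
have q0 : 0 < q%:R :> R by rewrite ltr0n.
set d : R := (4 * q%:R)^-1; have d0 : 0 < d by rewrite invr_gt0 mulr_gt0.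
have dE : (2 * q%:R)^-1 = 2 * d by rewrite /d; field; rewrite gt_eqF.
have timeE (u : int) (k : nat) : time (u + k%:Z) = time u + k%:R * (2 * d).
  by rewrite time_add dE.
have qd : (2 * q)%:R * (2 * d) = 1.
  by rewrite natrM /d; field; rewrite gt_eqF.
have last1 : time (i + (2 * q).-1%:Z) = 1 + time (i - 1).
  have -> : i + (2 * q).-1%:Z = i - 1 + 1 * (2 * q)%:Z by lia.
  by rewrite time_period addrC.
(* d is half the distance between two consecutive times *)
pose tau (k : nat) :=
  time (i + k%:Z) - (if (time (i - 1) == a) && (k == (2 * q).-1) then d else 0).
have tau_homo : {homo tau : k l / (k < l)%N >-> k < l}.
  move=> k l kl; rewrite /tau !timeE.
  have : (k%:R + 1) * (2 * d) <= l%:R * (2 * d).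
    by apply: ler_wpM2r; [lra | rewrite natr1 ler_nat].
  rewrite mulrDl mul1r => H.
  by do 2 case: ifP => _; lra.
have tau0 : a < tau 0%N.
  rewrite /tau addr0; have -> : (0 == (2 * q).-1)%N = false by lia.
  by rewrite andbF subr0.
have tau_gt k : a < tau k.
  by case: k => // k; apply: lt_trans tau0 _; exact: tau_homo.
exists [seq tau k | k <- iota 0 (2 * q)]; split.
- split; last by rewrite size_map size_iota.
  by apply: homo_sorted (iota_ltn_sorted _ _).
- move=> t /mapP[k]; rewrite mem_iota add0n => /andP[_ k2q] ->.
  rewrite tau_gt /=.
  have klast : time (i + k%:Z) <= 1 + time (i - 1).
    by rewrite -last1 leNgt time_lt; lia.
  rewrite /tau; case: ifP => [_|]; first by lra.
  move/negbT; rewrite negb_and subr0 => /orP[na|kN].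
    have : time (i - 1) < a by rewrite lt_neqAle na.
    by lra.
  have : time (i + k%:Z) < 1 + time (i - 1) by rewrite -last1 time_lt; lia.
  by lra.
- move=> t tc; have [u tE] := crossing_value_time tc.
  have [/andP[ta ta1] _] := tc.
  have tNa : t != a by apply/eqP => e0; apply: nca; rewrite -{2}e0.
  have tNa1 : t != a + 1 by apply/eqP => e0; apply: nca1; rewrite -e0.
  have at' : a < t by rewrite lt_neqAle eq_sym tNa.
  have ta1' : t < a + 1 by rewrite lt_neqAle tNa1.
  have iu : i <= u by rewrite -ltzD1 -ltrBlDr -time_lt -tE; exact: le_lt_trans at'.
  have ui : u < i + 1 * (2 * q)%:Z.
    by rewrite -time_lt time_period -tE; lra.
  apply/mapP; exists `|u - i|%N; first by rewrite mem_iota; lia.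
  have uE : i + `|u - i|%N%:Z = u by lia.
  rewrite /tau uE tE; case: ifP; rewrite ?subr0 // => /andP[/eqP ia /eqP ui'].
  by move: last1; rewrite -ui' uE -tE ia => t1; move: tNa1; rewrite t1 addrC eqxx.
- move=> N2 t /mapP[k]; rewrite mem_iota add0n => /andP[_ k2q] ->.
  have iNa : time (i - 1) == a = false.
    by apply/eqP => ia; apply: nca; rewrite -ia; apply: time_crossing_value => //; lra.
  have := tau_gt k; rewrite /tau iNa /= subr0 => atk.
  apply: time_crossing_value => //; rewrite ltW //= addrC.
  apply: (@le_trans _ _ (1 + time (i - 1))); last by lra.
  by rewrite -last1 leNgt time_lt; lia.
move=> k k2q; rewrite (nth_map 0%N) ?size_iota // nth_iota // add0n.
set m := ((k + j) %% (2 * q))%N.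
have m2q : (m < 2 * q)%N by rewrite ltn_mod; lia.
pose e2 : int := e + ((k + j) %/ (2 * q))%N%:Z.
have ikE : i + k%:Z = 2 * y + m%:Z + e2 * (2 * q)%:Z.
  have := divn_eq (k + j) (2 * q); rewrite -/m => h.
  have : k%:Z + j%:Z = ((k + j) %/ (2 * q))%N%:Z * (2 * q)%:Z + m%:Z.
    by rewrite -PoszD {1}h PoszD PoszM.
  by rewrite iE /e2; lia.
rewrite /tau; case: ifP => [/andP[/eqP ia /eqP kE]|_]; last by rewrite subr0 ikE factorE.
rewrite -(factorE m (e2 - 1) m2q).
have -> : 2 * y + m%:Z + (e2 - 1) * (2 * q)%:Z = i - 1.
  by move: ikE; rewrite kE mulrBl; lia.
rewrite !(no_crossing_factor hN hq hNq) // => k' l kl e'.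
  apply: nca; split; first by rewrite lexx lerDl ler01.
  by exists k', l; rewrite -ia.
have [u [c [uE _]]] := equal_heights_meet hN hq hNq kl e'.
by apply: (@half_unit_time (i + k%:Z) u); rewrite -uE.
Qed.

(** The times at which no strands cross contribute trivial factors and are left
    out of the product. *)
Lemma braid_reads_toric (b : bool) (a : R) :
    no_endpoint_crossing psi a -> factors_match N q p A B phi a b 0 ->
  braid_reads psi a (mirror_if b (toric_braid N q p A B)).
Proof.
move=> nec [ts [[ts_sorted ts_size] ts_in ts_all _ ts_factor]].
split; first exact: toric_regular.
exists [seq t <- ts | `[< crossing_value psi a t >]]; split.
- by apply: sorted_filter => //; exact: lt_trans.
- move=> t; rewrite mem_filter; split; first by move=> /andP[/asboolP].
  by move=> tc; rewrite ts_all // andbT; apply/asboolP.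
rewrite big_filter big_mkcond /= (eq_big_seq (crossing_factor psi)); last first.
  move=> t /ts_in/andP[at' ta]; case: asboolP => // nc.
  rewrite (no_crossing_factor hN hq hNq) // => k l kl e; apply: nc.
  by split; [rewrite !ltW // addrC | exists k, l].
rewrite toric_braidE mirror_if_prod.
rewrite [RHS](big_nth 0) ts_size (big_nth 1%g) size_toric_factors //.
by apply: eq_big_nat => k /andP[_ k2q]; rewrite ts_factor // addn0 modn_small.
Qed.

(** The equation for 2 y - 1 is solvable modulo q because p and 2 A are invertible;
    adding q, which is odd, adjusts the parity. *)
Lemma phase_parameters : ~ critical_phase N q p phi ->
  exists (n y h : int) (c : R),
    n + 2 * A * p%:Z * (2 * y - 1) = q%:Z * h /\
    ((1 < N)%N -> p%:R * (pi / (2 * q%:R) + phi) = pi * n%:~R / q%:R + c /\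
                  0 < c < pi / q%:R).
Proof.
move=> nc; have q0 : 0 < q%:R :> R by rewrite ltr0n.
have pi0 := pi_gt0 R.
set P := p%:R * (pi / (2 * q%:R) + phi).
have pq0 : 0 < pi / q%:R :> R by rewrite divr_gt0.
pose n := Num.floor (P / (pi / q%:R)).
have /andP[lo hi] := floor_itv (P / (pi / q%:R)); rewrite -/n in lo hi.
rewrite ler_pdivlMr // in lo; rewrite ltr_pdivrMr // intrD mulrDl mul1r in hi.
have nqE : n%:~R * (pi / q%:R) = pi * n%:~R / q%:R :> R by rewrite mulrC mulrAC.
rewrite nqE in lo hi.
have [y [h nh]] : exists y h : int, n + 2 * A * p%:Z * (2 * y - 1) = q%:Z * h.
  have [[u v] /= uv] : exists uv : int * int, uv.1 * p%:Z + uv.2 * q%:Z = 1.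
    by apply/coprimezP.
  pose x := - (n * N%:Z * u).
  pose g := n * (B + v - B * v * q%:Z).
  have xE : n + 2 * A * p%:Z * x = q%:Z * g.
    have -> : n + 2 * A * p%:Z * x = n * (1 - (2 * N%:Z * A) * (u * p%:Z)).
      by rewrite /x; ring.
    have -> : 2 * N%:Z * A = 1 - B * q%:Z by move: hAB; lia.
    have -> : u * p%:Z = 1 - v * q%:Z by move: uv; lia.
    by rewrite /g; ring.
  have := divz_eq x 2; have := modz_ge0 x (_ : 2 != 0); have := @ltz_pmod x 2.
  move: (_ %/ _)%Z (_ %% _)%Z => z r /(_ isT) r2 /(_ isT) r0 xz.
  have [r0'|r1] := eqVneq r 0.
    have qE : q%:Z = 2 * (q./2)%:Z + 1 by have := odd_double_half q; rewrite hqodd; lia.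
    exists (z + (q./2)%:Z + 1), (g + 2 * A * p%:Z); rewrite [RHS]mulrDr -xE.
    have -> : 2 * (z + (q./2)%:Z + 1) - 1 = x + q%:Z by rewrite qE xz r0'; ring.
    by ring.
  exists (z + 1), g; rewrite -xE; have -> : 2 * (z + 1) - 1 = x by lia.
  by [].
exists n, y, h, (P - pi * n%:~R / q%:R); split=> // N1; split; first by ring.
apply/andP; split; last by lra.
rewrite subr_gt0 lt_neqAle lo andbT; apply/eqP => nP; apply: nc.
exact: (critical_phase_multiple hN hq hp hpq hNq hNp N1 (n := n)).
Qed.

End Reading.

Lemma time_locate (R : realType) (N q : nat) (a : R) : (0 < q)%N ->
  exists i : int, crossing_time R N q (i - 1) <= a < crossing_time R N q i.
Proof.
move=> hq; have q0 : 0 < q%:R :> R by rewrite ltr0n.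
set x := (4 * q%:R * a - N%:R) / 2; exists (Num.floor x + 1).
have /andP[lo hi] := floor_itv x.
rewrite addrK /crossing_time ler_pdivrMr ?ltr_pdivlMr ?mulr_gt0 //.
by apply/andP; split; rewrite [a * _]mulrC; move: lo hi; rewrite /x; lra.
Qed.

(** The number q c / pi is a half-integer here, hence not an integer. *)
Lemma noncritical_phase (R : realType) (N q p : nat) (n : int) (phi : R) :
    (0 < N)%N -> (0 < q)%N -> (0 < p)%N -> coprime p q -> coprime N q -> coprime N p ->
    p%:R * (pi / (2 * q%:R) + phi) = pi * n%:~R / q%:R + pi / (2 * q%:R) ->
  ~ critical_phase N q p phi.
Proof.
move=> hN hq hp hpq hNq hNp phase.
move=> /(critical_phaseE hN hq hp hpq hNq hNp)[n' n'E].
have q0 := natr_neq0 R hq; have := pi_gt0 R => /gt_eqF/negbT pi0.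
have : (2 * n + 1)%:~R = (2 * n')%:~R :> R.
  apply: (mulfI (_ : pi / (2 * q%:R) != 0)).
    by rewrite mulf_neq0 // invr_eq0 mulf_neq0.
  have -> : pi / (2 * q%:R) * (2 * n')%:~R = pi * n'%:~R / q%:R :> R.
    by rewrite intrM; field; rewrite q0.
  by rewrite -n'E phase intrD intrM; field; rewrite q0.
by move/intr_inj; lia.
Qed.

Theorem mainTheorem1 (R : realType) (N q p : nat) (A B : int)
    (hN : (0 < N)%N) (hq : (0 < q)%N) (hp : (0 < p)%N) (hqodd : odd q)
    (hpq : coprime p q) (hNq : coprime N q) (hNp : coprime N p)
    (hAB : 2 * N%:Z * A + B * q%:Z = 1) :
  (* the stated expression of Q^-1, and the 2q factors of the braid *)
  [/\ (toric_Q N q p A B)^-1%g = (\prod_(g <- Qinv_factors N q p A B) g)%g,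
      size (toric_factors N q p A B) = (2 * q)%N
    & toric_braid N q p A B = (\prod_(g <- toric_factors N q p A B) g)%g] /\
  (* every non-critical phase: the knot, and the reading of its crossings *)
  (forall phi : R, ~ critical_phase N q p phi ->
     exists b : bool,
       [/\ represented_by (toric_knot N q p phi)
             (mirror_if b (toric_braid N q p A B)),
           forall eta : R, 0 < eta ->
             no_endpoint_crossing
               (@toric_strands R N q p (rescale_phase N phi)) eta ->
             exists j : nat, factors_match N q p A B phi eta b j
         & exists eta : R,
             [/\ 0 < eta < 1,
                 no_endpoint_crossing
                   (@toric_strands R N q p (rescale_phase N phi)) eta,
                 factors_match N q p A B phi eta b 0
               & braid_reads (@toric_strands R N q p (rescale_phase N phi)) eta
                   (mirror_if b (toric_braid N q p A B))]]) /\
  (* small eta and a suitable phase; the crossings closest to 0 are those of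
     alpha if N is 1 or 2 modulo 4, and those of beta otherwise *)
  (exists phi : R, ~ critical_phase N q p phi /\
     exists b : bool, \forall eta \near 0^'+,
       no_endpoint_crossing
         (@toric_strands R N q p (rescale_phase N phi)) eta /\
       factors_match N q p A B phi eta b
         (if (N %% 4 == 1)%N || (N %% 4 == 2)%N then 0%N else 1%N)).
Proof.
split.
  split; first exact: toric_QV.
    exact: (size_toric_factors hq hqodd hpq hAB).
  exact: toric_braidE.
split.
  move=> phi nc.
  have [n [y [h [c [nh phase]]]]] := phase_parameters hN hq hp hqodd hpq hNq hNp hAB nc.
  have factorE (m : nat) (e : int) : (m < 2 * q)%N -> _ :=
    crossing_factor_toric hN hq hqodd hpq hNq hNp hAB e phase nh (m := m).
  set b := ~~ odd `|h| in factorE.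
  have crossings eta i j e :=
    @factors_match_toric R N q p phi A B hN hq hp hqodd hpq hNq hNp hAB b y i e j eta factorE.
  have q0 : 0 < q%:R :> R by rewrite ltr0n.
  have [eta [eta01 nec etaM]] : exists eta : R, [/\ 0 < eta < 1,
      no_endpoint_crossing (@toric_strands R N q p (rescale_phase N phi)) eta
    & factors_match N q p A B phi eta b 0].
    (* A third of the way from t_(2y-1) to the next time: the numerator over 12 q
       is not divisible by 3, so x is not an integer. *)
    pose x : R := crossing_time R N q (2 * y - 1) + (6 * q%:R)^-1.
    have xE : x * (12 * q%:R) = (3 * N%:Z + 6 * (2 * y - 1) + 2)%:~R.
      rewrite !intrD !intrM intrB intrM /x /crossing_time /=.
      by field; rewrite gt_eqF.
    have /andP[lo hi] := floor_itv x; set z := Num.floor x in lo hi.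
    have zx : z%:~R != x.
      apply/eqP => zx; move: xE; rewrite -zx -[12]/(12%:~R) -[q%:R]/(q%:Z%:~R) -!intrM.
      by move/intr_inj; lia.
    pose i := 2 * y + (- z) * (2 * q)%:Z.
    have iE : crossing_time R N q (i - 1) = x - z%:~R - (6 * q%:R)^-1.
      have -> : i - 1 = (2 * y - 1) + (- z) * (2 * q)%:Z by rewrite /i; ring.
      by rewrite time_period // /x mulrNz; ring.
    have i1E : crossing_time R N q i = crossing_time R N q (i - 1) + (2 * q%:R)^-1.
      by rewrite -{1}(subrK 1 i) time_add // mul1r.
    have i6 : (0 : R) < (6 * q%:R)^-1 by rewrite invr_gt0 mulr_gt0.
    have i2 : (2 * q%:R)^-1 = 3 * (6 * q%:R)^-1 :> R by field; rewrite gt_eqF.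
    have between : crossing_time R N q (i - 1) < x - z%:~R < crossing_time R N q i.
      by rewrite i1E i2 iE; apply/andP; split; lra.
    have nec := between_times_no_crossing phi hN hq hp hqodd hpq hNq hNp hAB between.
    exists (x - z%:~R); split=> //.
      rewrite intrD in hi; apply/andP; split; last by lra.
      by rewrite subr_gt0 lt_neqAle zx lo.
    move: between => /andP[b1 b2].
    by apply: (crossings _ i 0%N (- z)); rewrite ?ltW //= /i addr0.
  have reads := braid_reads_toric hN hq hqodd hpq hNq hAB nec etaM.
  exists b; split.
  - exists (@toric_strands R N q p (rescale_phase N phi)), eta; split=> //.
    + exact: toric_geometric_braid.
    + move=> k t _ /=; have := sin_geN1 (2 * pi * q%:R / N%:R * (t + k%:R)); lra.
    + by rewrite -toric_knot_closure //; exact: isotopic_refl.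
  - move=> a _ neca; have [i ia] := time_locate N a hq.
    have q2 : (2 * q)%:Z != 0 by lia.
    have := divz_eq (i - 2 * y) (2 * q)%:Z; have := modz_ge0 (i - 2 * y) q2.
    move: (_ %/ _)%Z (_ %% _)%Z => e r r0 rE.
    exists `|r|%N; apply: (crossings _ i _ e) => //.
    by rewrite gez0_abs //; lia.
  - by exists eta.
set j := if _ then _ else _.
(* 2 y + j is the index of the first positive crossing time *)
have [y [yN Ny]] : exists y : int, N%:Z + 2 * (2 * y + j%:Z - 1) <= 0 /\
    0 < N%:Z + 2 * (2 * y + j%:Z).
  have := divn_eq N 4; have : (N %% 4 < 4)%N by rewrite ltn_mod.
  rewrite {}/j; move: (N %/ 4)%N (N %% 4)%N => m [|[|[|[|//]]]] _ NE /=.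
  - by exists (- m%:Z); lia.
  - by exists (- m%:Z); lia.
  - by exists (- m%:Z); lia.
  - by exists (- m%:Z - 1); lia.
(* The phase for which j_0 = 2 y - 1 and h = 0, c being half a step above the
   critical value. *)
pose n : int := - (2 * A * p%:Z * (2 * y - 1)).
have q0 : 0 < q%:R :> R by rewrite ltr0n.
have p0 := natr_neq0 R hp.
pose phi : R := (pi * n%:~R / q%:R + pi / (2 * q%:R)) / p%:R - pi / (2 * q%:R).
have phase : p%:R * (pi / (2 * q%:R) + phi) = pi * n%:~R / q%:R + pi / (2 * q%:R).
  by rewrite /phi [in LHS]addrC subrK mulrC divfK.
have half : 0 < (pi / (2 * q%:R) : R) < pi / q%:R.
  have pi0 := pi_gt0 R; rewrite divr_gt0 ?mulr_gt0 //= invfM mulrA.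
  have : 0 < pi / q%:R :> R by rewrite divr_gt0.
  by rewrite mulrAC; lra.
exists phi; split; first exact: noncritical_phase phase.
have i0 : 0 < crossing_time R N q (2 * y + j%:Z).
  rewrite /crossing_time divr_gt0 ?mulr_gt0 //.
  by move: Ny; rewrite -(ltr_int R) intrD intrM.
exists (~~ odd `|0%:Z|); near=> eta.
have eta0 : 0 < eta by near: eta; exact: nbhs_right_gt.
have etai : eta < crossing_time R N q (2 * y + j%:Z).
  by near: eta; exact: nbhs_right_lt.
have ieta : crossing_time R N q (2 * y + j%:Z - 1) < eta.
  apply: le_lt_trans eta0; rewrite /crossing_time ler_pdivrMr ?mulr_gt0 // mul0r.
  by move: yN; rewrite -(ler_int R) intrD intrM.
have nec : no_endpoint_crossing (@toric_strands R N q p (rescale_phase N phi)) eta.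
  apply: (@between_times_no_crossing R N q p phi A B hN hq hp hqodd hpq hNq hNp hAB
    eta (2 * y + j%:Z)).
  by rewrite ieta.
split=> //.
apply: (@factors_match_toric R N q p phi A B hN hq hp hqodd hpq hNq hNp hAB _ y
  (2 * y + j%:Z) 0) => //.
- move=> m e; apply: (crossing_factor_toric hN hq hqodd hpq hNq hNp hAB e (fun=> conj phase half)).
  by rewrite /n mulr0 addNr.
- by rewrite ltW.
- by rewrite mul0r addr0.
Unshelve. all: by end_near.
Qed.
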